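(* Let $N\ge3$. With respect to the path-lexicographic ordering of tree monomials with $\mu_2>\mu_N$, the reduced Gröbner basis of the operad $\mathcal{NA}_{2,N}$ (i.e. of its ideal of relations) is obtained from its defining relations $$\mu_2\star\mu_2=0,\qquad \mu_2\star\mu_N+\mu_N\star\mu_2=0,\qquad \mu_N\circ_i\mu_N=0\ \ (i=1,\ldots,N)$$ by adjoining, for each $k\ge1$ and each $i=1,\ldots,N-1$, the relation $$\mu_N\circ_i\big(\mu_2^{(k)}\circ_{k+1}\mu_N\big)=(-1)^{N(i-1)}\big(\mu_N\circ_N(\mu_2\circ_2\mu_N)\big)\circ_i\mu_2^{(k-1)},$$ where $\mu_2^{(0)}=\mathrm{id}$ and $\mu_2^{(k+1)}=\mu_2(\mathrm{id},\mu_2^{(k)})=\mu_2\circ_2\mu_2^{(k)}$.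
   Context: **Operad.** $\mathcal{NA}_{2,N}$ is the non-symmetric operad in graded $\mathbb{K}$-vector spaces ($\mathbb{K}$ a field) generated by a binary operation $\mu_2$ of degree $0$ and an $N$-ary operation $\mu_N$ of degree $2-N$, subject to the defining relations in the claim. Here, for $f$ of arity $k$ and $g$ of arity $l$ and degree $q$, $f\star g=\sum_{i=1}^k(-1)^{q(k-1)+(l-1)(i-1)}f\circ_i g$. Explicitly the first two relations are $\mu_2\circ_1\mu_2-\mu_2\circ_2\mu_2=0$ and $(-1)^N\mu_2\circ_1\mu_N-\mu_2\circ_2\mu_N+\sum_{i=1}^N(-1)^{i-1}\mu_N\circ_i\mu_2=0$. Partial compositions obey the graded associativity rules: for $\alpha,\beta,\gamma$ of arities $n,m,r$, $(\alpha\circ_i\beta)\circ_j\gamma$ equals $(-1)^{|\beta||\gamma|}(\alpha\circ_j\gamma)\circ_{i+r-1}\beta$ if $j<i$; $\alpha\circ_i(\beta\circ_{j-i+1}\gamma)$ if $i\le j\le i+m-1$; and $(-1)^{|\beta||\gamma|}(\alpha\circ_{j-m+1}\gamma)\circ_i\beta$ if $j\ge i+m$. **Tree monomials.** The free non-symmetric operad on $\mu_2,\mu_N$ has a basis of tree monomials (each determined up to sign): planar rooted trees whose vertices have $2$ inputs (label $\mu_2$) or $N$ inputs (label $\mu_N$), including the trivial tree $\mathrm{id}$. A tree monomial $S$ is *divisible* by $T$ if the underlying tree of $S$ contains that of $T$ as a subtree with matching labels. **Path-lexicographic ordering.** To a tree monomial assign the sequence of words, one for each leaf from left to right, given by the labels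 of the vertices met on the path from the root to that leaf. To compare two tree monomials, the one with more leaves is larger; if the numbers of leaves agree, compare the sequences word by word from the left, comparing words degree-lexicographically (longer words are larger; words of equal length are compared lexicographically with $\mu_2>\mu_N$). **Gröbner bases.** The leading term of a nonzero element is the largest tree monomial occurring in it with nonzero coefficient. A *Gröbner basis* of an ideal $I$ of the free operad is a set $G$ of generators of $I$ such that the leading term of every nonzero element of $I$ is divisible by the leading term of some element of $G$. It is *reduced* if no leading term of an element of $G$ is divisible by the leading term of another element of $G$. A relation $a=b$ is identified with the element $a-b$. *)

(* Defs.v *)
From HB Require Import structures.
From mathcomp Require Import all_boot all_order all_algebra.
From mathcomp Require Import finmap.
From mathcomp.multinomials Require Import monalg.
From mathcomp Require Import ring zify.

Set Implicit Arguments.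
Unset Strict Implicit.
Unset Printing Implicit Defensive.

Import GRing.Theory.
Local Open Scope ring_scope.

Variant gen := Mu2 | MuN.

Definition nat_of_gen (a : gen) : nat := if a is Mu2 then 0 else 1.
Definition gen_of_nat (n : nat) : gen := if n is 0 then Mu2 else MuN.

Lemma nat_of_genK : cancel nat_of_gen gen_of_nat.
Proof. by case. Qed.

HB.instance Definition _ := Countable.copy gen (can_type nat_of_genK).

Definition garity (N : nat) (a : gen) : nat := if a is Mu2 then 2 else N.
Definition gdeg (N : nat) (a : gen) : int := if a is Mu2 then 0 else 2 - N%:Z.

(* Planar rooted trees with vertices labelled by [gen]; [Leaf] alone is the
   trivial tree id.  The condition that a vertex has as many inputs as the arity
   of its label is the separate predicate [wf]. *)
Inductive ptree := Leaf | Node of gen & seq ptree.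

Fixpoint ptree_encode (t : ptree) : GenTree.tree unit :=
  match t with
  | Leaf => GenTree.Leaf tt
  | Node a ts => GenTree.Node (nat_of_gen a) (map ptree_encode ts)
  end.

Fixpoint ptree_decode (t : GenTree.tree unit) : ptree :=
  match t with
  | GenTree.Leaf _ => Leaf
  | GenTree.Node n ts => Node (gen_of_nat n) (map ptree_decode ts)
  end.

Lemma ptree_ind' (P : ptree -> Prop) :
  P Leaf ->
  (forall a ts, foldr (fun t Q => P t /\ Q) True ts -> P (Node a ts)) ->
  forall t, P t.
Proof.
move=> PL PN; fix IH 1; case=> [//|a ts]; apply: PN.
by elim: ts => [//|t ts IHts]; split; [exact: IH | exact: IHts].
Qed.

Lemma ptree_encodeK : cancel ptree_encode ptree_decode.
Proof.
elim/ptree_ind' => [//|a ts IH] /=; rewrite nat_of_genK; congr Node.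
by elim: ts IH => [//|t ts IHts] /= [-> /IHts ->].
Qed.

HB.instance Definition _ := Countable.copy ptree (can_type ptree_encodeK).

Fixpoint wf (N : nat) (t : ptree) : bool :=
  if t is Node a ts then (size ts == garity N a) && all (wf N) ts else true.

Fixpoint leaves (t : ptree) : nat :=
  if t is Node _ ts then sumn (map leaves ts) else 1.

Fixpoint tdeg (N : nat) (t : ptree) : int :=
  if t is Node a ts then gdeg N a + foldr +%R 0 (map (tdeg N) ts) else 0.

(* Graft [t] on the [i]-th leaf of [s], leaves being numbered from 1. *)
Fixpoint graft (s : ptree) (i : nat) (t : ptree) : ptree :=
  match s with
  | Leaf => t
  | Node a ss =>
    Node a ((fix graft_seq ss i :=
      match ss with
      | [::] => [::]
      | u :: us => if (i <= leaves u)%N then graft u i t :: us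
                   else u :: graft_seq us (i - leaves u)%N
      end) ss i)
  end.

(* Total degree of the vertices of [s] lying to the right of its [i]-th leaf,
   i.e. coming after that leaf in depth-first order from left to right. *)
Fixpoint rdeg (N : nat) (s : ptree) (i : nat) : int :=
  match s with
  | Leaf => 0
  | Node _ ss =>
    (fix rdeg_seq ss i :=
      match ss with
      | [::] => 0
      | u :: us =>
        if (i <= leaves u)%N then rdeg N u i + foldr +%R 0 (map (tdeg N) us)
        else rdeg_seq us (i - leaves u)%N
      end) ss i
  end.

Lemma leaves_graft s i t : (1 <= i <= leaves s)%N ->
  leaves (graft s i t) = (leaves s + leaves t - 1)%N.
Proof.
elim/ptree_ind': s i => [|a ss IH] i /=; first lia.
elim: ss i IH => [|u us IHs] i /=; first lia.
case=> IHu IHus Hi; case: leqP => Hu /=.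
  by rewrite IHu; lia.
by have := IHs (i - leaves u)%N IHus; lia.
Qed.

Lemma tdeg_graft N s i t : (1 <= i <= leaves s)%N ->
  tdeg N (graft s i t) = tdeg N s + tdeg N t.
Proof.
elim/ptree_ind': s i => [|a ss IH] i /= Hi; first by rewrite add0r.
rewrite -addrA; congr (_ + _); move: Hi.
elim: ss i IH => [|u us IHs] i /=; first lia.
case=> IHu IHus Hi; case: leqP => Hu /=.
  by rewrite IHu; [ring | lia].
by rewrite IHs //; [ring | lia].
Qed.


Lemma graft_left s i t j u : (1 <= j < i)%N -> (i <= leaves s)%N ->
  graft (graft s i t) j u = graft (graft s j u) (i + leaves u - 1) t.
Proof.
elim/ptree_ind': s i j => [|a ss IH] i j /= Hj Hi; first lia.
congr Node; move: Hj Hi.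
elim: ss i j IH => [|v vs IHs] i j //= [IHv IHvs] Hj Hi.
case: (leqP i (leaves v)) => Hiv /=.
  have -> : (j <= leaves v)%N by lia.
  rewrite /= !leaves_graft; try lia.
  have -> : (j <= leaves v + leaves t - 1)%N by lia.
  have -> : (i + leaves u - 1 <= leaves v + leaves u - 1)%N by lia.
  by rewrite IHv.
case: (leqP j (leaves v)) => Hjv /=.
  rewrite leaves_graft; last lia.
  have -> : (i + leaves u - 1 <= leaves v + leaves u - 1)%N = false by lia.
  by have -> : (i + leaves u - 1 - (leaves v + leaves u - 1) = i - leaves v)%N by lia.
have -> : (i + leaves u - 1 <= leaves v)%N = false by lia.
rewrite IHs //; try lia.
by have -> : (i - leaves v + leaves u - 1 = i + leaves u - 1 - leaves v)%N by lia.
Qed.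

Lemma graft_nested s i t j u : (1 <= i <= leaves s)%N ->
  (i <= j <= i + leaves t - 1)%N ->
  graft (graft s i t) j u = graft s i (graft t (j - i + 1) u).
Proof.
elim/ptree_ind': s i j => [|a ss IH] i j /= Hi Hj.
  by congr graft; lia.
congr Node; move: Hi Hj.
elim: ss i j IH => [|v vs IHs] i j //= [IHv IHvs] Hi Hj.
case: (leqP i (leaves v)) => Hiv /=.
  rewrite leaves_graft; last lia.
  have -> : (j <= leaves v + leaves t - 1)%N by lia.
  by rewrite IHv //; lia.
have -> : (j <= leaves v)%N = false by lia.
rewrite IHs //; try lia.
by have -> : (j - leaves v - (i - leaves v) + 1 = j - i + 1)%N by lia.
Qed.

Lemma rdeg_left1 N s i t j : (1 <= j < i)%N -> (i <= leaves s)%N ->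
  rdeg N (graft s i t) j = rdeg N s j + tdeg N t.
Proof.
elim/ptree_ind': s i j => [|a ss IH] i j /= Hj Hi; first lia.
elim: ss i j IH Hj Hi => [|v vs IHs] i j //=; first lia.
move=> [IHv IHvs] Hj Hi.
case: (leqP i (leaves v)) => Hiv /=.
  have -> : (j <= leaves v)%N by lia.
  rewrite leaves_graft; last lia.
  have -> : (j <= leaves v + leaves t - 1)%N by lia.
  by rewrite IHv //; ring.
case: (leqP j (leaves v)) => Hjv /=; last by rewrite IHs //; lia.
have := @tdeg_graft N (Node Mu2 vs) (i - leaves v)%N t; rewrite /= => H.
have {H} := H ltac:(lia) => H.
by rewrite -addrA; congr (_ + _); apply: (@addrI _ (gdeg N Mu2)); rewrite H; ring.
Qed.

Lemma rdeg_left2 N s i j u : (1 <= j < i)%N -> (i <= leaves s)%N ->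
  rdeg N (graft s j u) (i + leaves u - 1) = rdeg N s i.
Proof.
elim/ptree_ind': s i j => [|a ss IH] i j /= Hj Hi; first lia.
elim: ss i j IH Hj Hi => [|v vs IHs] i j //= [IHv IHvs] Hj Hi.
case: (leqP j (leaves v)) => Hjv /=.
  rewrite leaves_graft; last lia.
  case: (leqP i (leaves v)) => Hiv.
    have -> : (i + leaves u - 1 <= leaves v + leaves u - 1)%N by lia.
    by rewrite IHv.
  have -> : (i + leaves u - 1 <= leaves v + leaves u - 1)%N = false by lia.
  by have -> : (i + leaves u - 1 - (leaves v + leaves u - 1) = i - leaves v)%N by lia.
have -> : (i <= leaves v)%N = false by lia.
have -> : (i + leaves u - 1 <= leaves v)%N = false by lia.
rewrite -(IHs _ (j - leaves v)%N) //; try lia.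
by have -> : (i - leaves v + leaves u - 1 = i + leaves u - 1 - leaves v)%N by lia.
Qed.

Lemma rdeg_nested N s i t j : (1 <= i <= leaves s)%N ->
  (i <= j <= i + leaves t - 1)%N ->
  rdeg N (graft s i t) j = rdeg N t (j - i + 1) + rdeg N s i.
Proof.
elim/ptree_ind': s i j => [|a ss IH] i j /= Hi Hj.
  by rewrite addr0; congr rdeg; lia.
elim: ss i j IH Hi Hj => [|v vs IHs] i j //=; first lia.
move=> [IHv IHvs] Hi Hj.
case: (leqP i (leaves v)) => Hiv /=.
  rewrite leaves_graft; last lia.
  have -> : (j <= leaves v + leaves t - 1)%N by lia.
  by rewrite IHv //; try ring; lia.
have -> : (j <= leaves v)%N = false by lia.
by rewrite IHs //; try lia; congr (rdeg _ _ _ + _); lia.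
Qed.

Definition corolla (N : nat) (a : gen) : ptree :=
  Node a (nseq (garity N a) Leaf).

Fixpoint lex_lt (T : eqType) (lt : rel T) (u v : seq T) : bool :=
  match u, v with
  | _, [::] => false
  | [::], _ :: _ => true
  | x :: u', y :: v' => lt x y || ((x == y) && lex_lt lt u' v')
  end.

Definition gen_lt : rel gen := fun a b => (a == MuN) && (b == Mu2).

Definition word_lt : rel (seq gen) := fun u v =>
  (size u < size v)%N || ((size u == size v) && lex_lt gen_lt u v).

Fixpoint paths (t : ptree) : seq (seq gen) :=
  match t with
  | Leaf => [:: [::]]
  | Node a ts => map (cons a) (flatten (map paths ts))
  end.

Definition tree_lt : rel ptree := fun s t =>
  (leaves s < leaves t)%N ||
  ((leaves s == leaves t) && lex_lt word_lt (paths s) (paths t)).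

(* [subtree_at t s]: the tree [t] occurs in [s] with the root of [t] placed at
   the root of [s]; the leaves of [t] may cover arbitrary subtrees of [s]. *)
Fixpoint subtree_at (t s : ptree) : bool :=
  match t, s with
  | Leaf, _ => true
  | Node _ _, Leaf => false
  | Node a ts, Node b ss => (a == b) && all2 subtree_at ts ss
  end.

(* [divides t s]: the tree monomial [s] is divisible by [t]. *)
Fixpoint divides (t s : ptree) : bool :=
  subtree_at t s || (if s is Node _ ss then has (divides t) ss else false).

Section FreeOperad.

Variables (K : fieldType) (N : nat).

Notation elt := {malg K[ptree]}.

(* The component of arity [n] of the free operad. *)
Definition component (n : nat) (f : elt) : Prop :=
  forall t, t \in msupp f -> wf N t /\ leaves t = n.

Definition deg_part (d : int) (f : elt) : elt :=
  \sum_(t <- msupp f | tdeg N t == d) << f@_t *g t >>.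

(* The basis element << s >> stands for the composite of the generators labelling
   the vertices of [s], grafted in depth-first order from left to right:
   << Node a [:: t_1; t_2; ..] >> is
   (<< corolla N a >> \circ_(1) << t_1 >>) \circ_(leaves t_1 + 1) << t_2 >> ..
   without sign.  The sign in [opcomp] moves the vertices of [t] across those of
   [s] lying to the right of the [i]-th leaf. *)
Definition opcomp (f : elt) (i : nat) (g : elt) : elt :=
  \sum_(s <- msupp f) \sum_(t <- msupp g)
    << f@_s * g@_t * (-1) ^ (tdeg N t * rdeg N s i) *g graft s i t >>.

Local Notation "f \circ_( i ) g" := (opcomp f i g)
  (at level 40, i at level 99, left associativity).

Local Notation sg x := ((-1 : K) ^ x).

Lemma scalerU (a c : K) (t : ptree) : a *: << c *g t >> = << a * c *g t >>.
Proof. by apply/malgP => k; rewrite mcoeffZ !mcoeffU mulrnAr. Qed.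

Lemma opcompU (s t : ptree) i c d :
  << c *g s >> \circ_(i) << d *g t >>
  = << c * d * sg (tdeg N t * rdeg N s i) *g graft s i t >>.
Proof.
rewrite /opcomp.
case: (eqVneq c 0) => [->|c0].
  by rewrite monalgU0 msupp0 big_seq_fset0 !mul0r monalgU0.
case: (eqVneq d 0) => [->|d0].
  rewrite monalgU0 msupp0 mulr0 mul0r monalgU0 big1 // => x _.
  by rewrite big_seq_fset0.
by rewrite !msuppU (negPf c0) (negPf d0) !big_seq_fset1 !mcoeffU !eqxx.
Qed.

Lemma opcomp1 (s t : ptree) i :
  << s >> \circ_(i) << t >> = << sg (tdeg N t * rdeg N s i) *g graft s i t >>.
Proof. by rewrite opcompU !mul1r. Qed.

Lemma sgD (a b : int) : sg a * sg b = sg (a + b).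
Proof. by rewrite expfzDr // oppr_eq0 oner_eq0. Qed.

(* The graded associativity rules, on basis elements. *)
Lemma opcomp_left (s t u : ptree) i j : (1 <= j < i)%N -> (i <= leaves s)%N ->
  (<< s >> \circ_(i) << t >>) \circ_(j) << u >>
  = sg (tdeg N t * tdeg N u) *:
    ((<< s >> \circ_(j) << u >>) \circ_(i + leaves u - 1) << t >>).
Proof.
move=> Hj Hi; rewrite !opcomp1 !opcompU !mulr1 scalerU.
rewrite (rdeg_left1 _ _ Hj Hi) (rdeg_left2 _ _ Hj Hi) (graft_left _ _ Hj Hi).
by rewrite !sgD; congr (<< sg _ *g _ >>); ring.
Qed.

Lemma opcomp_nested (s t u : ptree) i j : (1 <= i <= leaves s)%N ->
  (i <= j <= i + leaves t - 1)%N ->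
  (<< s >> \circ_(i) << t >>) \circ_(j) << u >>
  = << s >> \circ_(i) (<< t >> \circ_(j - i + 1) << u >>).
Proof.
move=> Hi Hj; rewrite !opcomp1 !opcompU mulr1 mul1r.
rewrite (rdeg_nested _ Hi Hj) (graft_nested _ Hi Hj) tdeg_graft; last lia.
by rewrite !sgD; congr (<< sg _ *g _ >>); ring.
Qed.

Lemma opcomp_right (s t u : ptree) i j : (1 <= i)%N ->
  (i + leaves t <= j <= leaves s + leaves t - 1)%N ->
  (<< s >> \circ_(i) << t >>) \circ_(j) << u >>
  = sg (tdeg N t * tdeg N u) *:
    ((<< s >> \circ_(j - leaves t + 1) << u >>) \circ_(i) << t >>).
Proof.
move=> Hi Hj; rewrite [in RHS]opcomp_left; try lia.
have -> : (j - leaves t + 1 + leaves t - 1 = j)%N by lia.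
by rewrite scalerA [tdeg N u * _]mulrC -expfzMl mulrNN mulr1 exp1rz scale1r.
Qed.
Definition mu2 : elt := << corolla N Mu2 >>.
Definition muN : elt := << corolla N MuN >>.

Fixpoint mu2pow (k : nat) : elt :=
  if k is k'.+1 then mu2 \circ_(2) mu2pow k' else << Leaf >>.

(* [star k f l q g] is f \star g for f of arity k and g of arity l, degree q. *)
Definition star (k : nat) (f : elt) (l : nat) (q : int) (g : elt) : elt :=
  \sum_(1 <= i < k.+1)
    (-1) ^ (q * (k%:Z - 1) + (l%:Z - 1) * (i%:Z - 1)) *: (f \circ_(i) g).

Inductive defining_relation : elt -> Prop :=
  | Rel22 : defining_relation (star 2 mu2 2 0 mu2)
  | Rel2N : defining_relation (star 2 mu2 N (2 - N%:Z) muN + star N muN 2 0 mu2)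
  | RelNN i : (1 <= i <= N)%N -> defining_relation (muN \circ_(i) muN).

Inductive groebner_relation : elt -> Prop :=
  | Defining f : defining_relation f -> groebner_relation f
  | Adjoined k i : (1 <= k)%N -> (1 <= i <= N - 1)%N ->
      groebner_relation
        (muN \circ_(i) (mu2pow k \circ_(k.+1) muN)
         - (-1) ^+ (N * (i - 1)) *:
           ((muN \circ_(N) (mu2 \circ_(2) muN)) \circ_(i) mu2pow (k - 1))).

(* Operadic ideals: families of graded subspaces of the components, stable under
   partial compositions on both sides. *)
Record is_ideal (I : nat -> elt -> Prop) : Prop := IsIdeal {
  ideal_component : forall n f, I n f -> component n f;
  ideal0 : forall n, I n 0;
  ideal_linear : forall n (a : K) f g, I n f -> I n g -> I n (a *: f + g);
  ideal_graded : forall n d f, I n f -> I n (deg_part d f);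
  ideal_compl : forall n m i f g, (1 <= i <= n)%N ->
    I n f -> component m g -> I (n + m - 1)%N (f \circ_(i) g);
  ideal_compr : forall n m i f g, (1 <= i <= n)%N ->
    component n f -> I m g -> I (n + m - 1)%N (f \circ_(i) g) }.

Definition ideal_generated (R : elt -> Prop) (n : nat) (f : elt) : Prop :=
  forall I, is_ideal I ->
    (forall m g, R g -> component m g -> I m g) -> I n f.

Definition leading_term (f : elt) (t : ptree) : Prop :=
  t \in msupp f /\ forall s, s \in msupp f -> s = t \/ tree_lt s t.

Definition groebner_basis (I : nat -> elt -> Prop) (G : elt -> Prop) : Prop :=
  [/\ forall g, G g -> exists n, I n g,
      forall n f, I n f <-> ideal_generated G n f
    & forall n f, I n f -> f != 0 ->
        exists t, leading_term f t /\
          exists g u, [/\ G g, leading_term g u & divides u t]].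

Definition reduced (G : elt -> Prop) : Prop :=
  forall f g s t, G f -> G g -> f <> g ->
    leading_term f s -> leading_term g t -> ~~ divides t s.

End FreeOperad.

(* Main.v *)
Require Import Defs.
From mathcomp Require Import all_boot all_order all_algebra.
From HB Require Import structures.
From mathcomp Require Import finmap.
From mathcomp.multinomials Require Import monalg.
From mathcomp Require Import ring zify.
From Stdlib Require Import Classical_Prop.

(* Call a tree monomial normal if no leading term of the listed relations
   divides it: the normal monomials are
     x^u mu_N(x^c_1, .., x^c_(N-1), x^c_N mu_N(x^c_(N+1), ..)),
   where x^c stands for the right comb with c leaves.

   That nothing normal is a leading term of the ideal is seen in a model.  In an
   algebra with a superderivation d such that d d = 0, let mu_2 be the product
   and let mu_N send a_1, .., a_N to d a_1 .. d a_N, with the Koszul signs.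
   Leibniz's rule telescopes to the relation between mu_2 and mu_N, and d d = 0
   kills every mu_N o_i mu_N, so the elements of the free operad that evaluate
   to 0 on all arguments form an ideal containing the relations.  The normal
   monomials take the values x^u d(x^c_1) .. d(x^c_r), which are linearly
   independent when d is the supercommutator with a central-square element D that
   exchanges two free letters a = x and b: up to sign the word
   a^u b^c_1 a^c_2 b^c_3 .. occurs in that value only.  Finally, the value of an
   arbitrary monomial is a combination of the values of normal monomials that
   are not larger than it, by induction on the monomial; the comparison is
   decided at the first leaf when the root is mu_2, and at the first input that
   is not a right comb when it is mu_N.

   The adjoined relations hold because, modulo the ideal, composing the relation
   between mu_2 and mu_N with mu_N on either side moves mu_2 o_2 mu_N from the
   i-th input of mu_N to the next one. *)

Set Implicit Arguments.
Unset Strict Implicit.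
Unset Printing Implicit Defensive.

Import GRing.Theory.
Local Open Scope ring_scope.

(** * Normal monomials and the path-lexicographic order *)

Section LexicographicOrder.

Context (T : eqType) (lt : rel T).
Context (lt_irr : irreflexive lt) (lt_trans : transitive lt).

Lemma lex_lt_irr : irreflexive (lex_lt lt).
Proof. by elim=> //= x s ->; rewrite lt_irr eqxx. Qed.

Lemma lex_lt_trans : transitive (lex_lt lt).
Proof.
elim=> [|y s IH] [|x r] [|z t] //=.
case/orP=> [xy|/andP[/eqP <- rs]]; case/orP=> [yz|/andP[/eqP <- st]].
- by rewrite (lt_trans xy yz).
- by rewrite xy.
- by rewrite yz.
- by rewrite eqxx (IH _ _ rs st) orbT.
Qed.

Lemma lex_lt_total : (forall x y, [|| lt x y, x == y | lt y x]) ->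
  forall s t, [|| lex_lt lt s t, s == t | lex_lt lt t s].
Proof.
move=> lt_total; elim=> [|x s IH] [|y t] //=; rewrite eqseq_cons [y == x]eq_sym.
case/or3P: (lt_total x y) => [->|/eqP ->|->]; rewrite ?orbT // eqxx.
by case/or3P: (IH t) => [->|->|->]; rewrite ?orbT.
Qed.

Lemma lex_lt_cat s s' t t' : size s = size s' ->
  lex_lt lt s s' -> lex_lt lt (s ++ t) (s' ++ t').
Proof.
elim: s s' => [|x s IH] [|x' s'] //= [sz] /orP[->//|/andP[-> /(IH _ sz) ->]].
by rewrite orbT.
Qed.

Lemma lex_lt_catl p s t : lex_lt lt (p ++ s) (p ++ t) = lex_lt lt s t.
Proof. by elim: p => //= x p IH; rewrite lt_irr eqxx. Qed.

Lemma lex_lt_map f s t : {mono f : x y / lt x y} -> injective f ->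
  lex_lt lt (map f s) (map f t) = lex_lt lt s t.
Proof.
move=> f_mono f_inj.
by elim: s t => [|x s IH] [|y t] //=; rewrite f_mono (inj_eq f_inj) IH.
Qed.

(** The first difference between [s] and [t] falls either before the cut or after it. *)
Lemma lex_lt_take n s t : size s = size t -> lex_lt lt s t ->
  take n s = take n t \/ lex_lt lt (take n s) (take n t).
Proof.
elim: s t n => [|x s IH] [|y t] [|n] //=; try by left.
move=> [sz] /orP[xy|/andP[/eqP <- st]]; first by right; rewrite xy.
by case: (IH t n sz st) => [->|->]; [left | right; rewrite eqxx orbT].
Qed.

End LexicographicOrder.

Lemma gen_lt_irr : irreflexive gen_lt. Proof. by case. Qed.
Lemma gen_lt_trans : transitive gen_lt. Proof. by do 3!case. Qed.
Lemma gen_lt_total a b : [|| gen_lt a b, a == b | gen_lt b a].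
Proof. by case: a b => [] []. Qed.

Lemma word_lt_irr : irreflexive word_lt.
Proof. by move=> u; rewrite /word_lt ltnn eqxx lex_lt_irr //; apply: gen_lt_irr. Qed.

Lemma word_lt_trans : transitive word_lt.
Proof.
move=> v u w; rewrite /word_lt.
case/orP=> [uv|/andP[/eqP -> uv]] /orP[vw|/andP[/eqP <- vw]]; rewrite ?uv ?vw //.
  by rewrite (ltn_trans uv vw).
by rewrite eqxx (lex_lt_trans gen_lt_trans uv vw) orbT.
Qed.

Lemma word_lt_total u v : [|| word_lt u v, u == v | word_lt v u].
Proof.
rewrite /word_lt; case: (ltngtP (size u) (size v)) => _ //=; rewrite ?orbT //.
exact: lex_lt_total gen_lt_total u v.
Qed.

Lemma word_lt_cons a : {mono cons a : u v / word_lt u v}.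
Proof.
by move=> u v; rewrite /word_lt /= ltnS eqSS gen_lt_irr eqxx.
Qed.

Local Notation paths_lt := (lex_lt word_lt).

Lemma paths_lt_irr : irreflexive paths_lt.
Proof. exact/lex_lt_irr/word_lt_irr. Qed.

Lemma paths_lt_trans : transitive paths_lt.
Proof. exact/lex_lt_trans/word_lt_trans. Qed.

Lemma paths_lt_cons a p q : paths_lt (map (cons a) p) (map (cons a) q) = paths_lt p q.
Proof. by apply: lex_lt_map => [u v|u v []] //; apply: word_lt_cons. Qed.

Lemma tree_lt_irr : irreflexive tree_lt.
Proof. by move=> t; rewrite /tree_lt ltnn eqxx paths_lt_irr. Qed.

Lemma tree_lt_trans : transitive tree_lt.
Proof.
move=> t s u; rewrite /tree_lt.
case/orP=> [st|/andP[/eqP -> st]] /orP[tu|/andP[/eqP <- tu]]; rewrite ?st ?tu //.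
  by rewrite (ltn_trans st tu).
by rewrite eqxx (paths_lt_trans st tu) orbT.
Qed.

Lemma tree_lt_leaves s t : leaves s = leaves t ->
  tree_lt s t = paths_lt (paths s) (paths t).
Proof. by move=> st; rewrite /tree_lt st ltnn eqxx. Qed.

Lemma size_flatten_paths ts :
  foldr (fun t Q => size (paths t) = leaves t /\ Q) True ts ->
  size (flatten (map paths ts)) = sumn (map leaves ts).
Proof. by elim: ts => //= t ts IH [Ht /IH <-]; rewrite size_cat Ht. Qed.

Lemma size_paths t : size (paths t) = leaves t.
Proof.
elim/ptree_ind': t => //= a ts IH; rewrite size_map; exact: size_flatten_paths.
Qed.

Definition tree_le (s t : ptree) : bool := (s == t) || tree_lt s t.

Definition comb (k : nat) (t : ptree) : ptree :=
  iter k (fun t => Node Mu2 [:: Leaf; t]) t.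

(** Both [word 0] and [word 1] are the trivial tree, hence the positivity conditions on exponents
    below. *)
Definition word (c : nat) : ptree := comb c.-1 Leaf.

Lemma leaves_comb k t : leaves (comb k t) = (k + leaves t)%N.
Proof. by elim: k => //= k ->; lia. Qed.

Lemma leaves_word c : (0 < c)%N -> leaves (word c) = c.
Proof. by move=> c0; rewrite leaves_comb /=; lia. Qed.

Lemma leaves_words cs : all (fun c => 0 < c)%N cs ->
  sumn (map leaves (map word cs)) = sumn cs.
Proof. by elim: cs => //= c cs IH /andP[/leaves_word -> /IH ->]. Qed.

Lemma paths_comb k t : paths (comb k t) =
  mkseq (fun i => nseq i.+1 Mu2) k ++ map (cat (nseq k Mu2)) (paths t).
Proof.
elim: k => [|k IH]; first by rewrite /= map_id.
rewrite /= -/(comb k t) IH cats0 map_cat -!map_comp /mkseq /=.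
by rewrite -add1n iotaDl -map_comp.
Qed.

(** The two lists agree on the first v - 1 leaves. The next leaf has depth v - 1 in [word v], where
    it ends the comb, but depth v in [comb v t]. *)
Lemma paths_word_comb v t : (0 < v)%N ->
  paths_lt (paths (word v)) (take v (paths (comb v t))).
Proof.
case: v => // v _; rewrite /word -[v.+1.-1]/v !paths_comb.
rewrite take_size_cat ?size_mkseq // mkseqS -cats1 lex_lt_catl; last exact: word_lt_irr.
by rewrite /= /word_lt /= cats0 size_nseq ltnSn.
Qed.

(** The common inputs [ws] contribute equal paths, and the leaves of [word v] face the first v
    leaves of [s]; the comparison is decided there, whatever follows. *)
Lemma tree_lt_muN_word ws v s rest rest' : (0 < v)%N -> (v <= leaves s)%N ->
  paths_lt (paths (word v)) (take v (paths s)) ->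
  leaves (Node MuN (ws ++ word v :: rest)) = leaves (Node MuN (ws ++ s :: rest')) ->
  tree_lt (Node MuN (ws ++ word v :: rest)) (Node MuN (ws ++ s :: rest')).
Proof.
move=> v0 vs lt_v /tree_lt_leaves ->.
rewrite /= paths_lt_cons !map_cat !flatten_cat lex_lt_catl; last exact: word_lt_irr.
rewrite /= -[paths s](cat_take_drop v) -catA; apply: lex_lt_cat lt_v.
by rewrite size_takel size_paths ?leaves_word.
Qed.

Lemma tree_le_last a ws s t : leaves s = leaves t -> tree_le s t ->
  tree_le (Node a (rcons ws s)) (Node a (rcons ws t)).
Proof.
move=> st /orP[/eqP ->|lt_st]; first by rewrite /tree_le eqxx.
apply/orP; right; rewrite tree_lt_leaves; last by rewrite /= !map_rcons !sumn_rcons st.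
rewrite /= paths_lt_cons !map_rcons -!cats1 !flatten_cat lex_lt_catl /= ?cats0.
  by rewrite -tree_lt_leaves.
exact: word_lt_irr.
Qed.

(** * Normal monomials as the irreducible ones *)

Section Trees.

Context (N : nat).
Context (hN : (3 <= N)%N).

Lemma garity_gt1 a : (1 < garity N a)%N.
Proof. by case: a => //=; apply: leq_trans hN. Qed.

Lemma leaves_gt0 t : wf N t -> (0 < leaves t)%N.
Proof.
elim/ptree_ind': t => //= a [|t ts] IH /andP[/eqP sz /=].
  by have := garity_gt1 a; rewrite -sz.
by case: IH => IH _ /andP[/IH]; rewrite addn_gt0 => ->.
Qed.

(* The prefix q makes the statement provable by induction: the subtrees of a
   vertex are read off one after the other from the list of paths. *)
Lemma paths_inj_cat t s q u v : wf N t -> wf N s ->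
  map (cat q) (paths t) ++ u = map (cat q) (paths s) ++ v -> t = s /\ u = v.
Proof.
have head_paths t' : wf N t' -> exists w p, paths t' = w :: p.
  move=> /leaves_gt0; rewrite -size_paths; case: (paths t') => // w p _.
  by exists w, p.
have nodeE a ts q' : wf N (Node a ts) -> exists w p,
    map (cat q') (paths (Node a ts)) = (q' ++ a :: w) :: p.
  case: ts => [|t0 ts] /= /andP[/eqP sz]; first by have := garity_gt1 a; rewrite -sz.
  case/andP=> /head_paths[w [p ->]] _ /=; by exists w; eexists.
have absurd x (w : seq gen) q' : q' = q' ++ x :: w -> False.
  by move/(congr1 size); rewrite size_cat /=; lia.
elim/ptree_ind': t s q u v => [|a ts IH] [|b ss] q u v wf_t wf_s.
- by rewrite /= cats0 => -[].
- have [w [p ->]] := nodeE b ss q wf_s.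
  by rewrite /= cats0 => -[] /absurd.
- have [w [p ->]] := nodeE a ts q wf_t.
  by rewrite /= cats0 => -[] /esym/absurd.
move=> E; have ab : a = b.
  have [w [p Ea]] := nodeE a ts q wf_t; have [w' [p' Eb]] := nodeE b ss q wf_s.
  move: E; rewrite Ea Eb /= => -[] /eqP.
  by rewrite eqseq_cat // eqxx /= => /eqP[].
subst b; move: E; rewrite /= -!map_comp.
rewrite !(eq_map (g := cat (rcons q a))); try by move=> w /=; rewrite cat_rcons.
case/andP: wf_t => /eqP sz_t wf_ts; case/andP: wf_s => /eqP sz_s wf_ss E.
suff [-> ->] : ts = ss /\ u = v by [].
have sz : size ts = size ss by rewrite sz_t.
move: (rcons q a) E => r {sz_t sz_s}.
elim: ts ss IH wf_ts wf_ss sz => [|t ts IHts] [|s ss] //=.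
move=> [IHt IHl] /andP[wf_t wf_ts] /andP[wf_s wf_ss] [sz].
rewrite !map_cat -!catA => /(IHt _ _ _ _ wf_t wf_s) [-> ].
by case/(IHts _ IHl wf_ts wf_ss sz) => -> ->.
Qed.

Lemma paths_inj t s : wf N t -> wf N s -> paths t = paths s -> t = s.
Proof.
move=> wf_t wf_s E; have := @paths_inj_cat t s [::] [::] [::] wf_t wf_s.
by rewrite E => /(_ erefl) [].
Qed.

Lemma tree_le_paths s t : wf N s -> wf N t -> leaves s = leaves t ->
  tree_le s t = (paths s == paths t) || paths_lt (paths s) (paths t).
Proof.
move=> wf_s wf_t st; rewrite /tree_le tree_lt_leaves //; congr (_ || _).
by apply/eqP/eqP => [->|/(paths_inj wf_s wf_t)].
Qed.

Lemma tree_total s t : wf N s -> wf N t -> leaves s = leaves t ->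
  tree_le s t \/ tree_lt t s.
Proof.
move=> wf_s wf_t st; rewrite tree_le_paths // tree_lt_leaves //.
have := lex_lt_total word_lt_total (paths s) (paths t).
by case/or3P=> ->; rewrite ?orbT; [left | left | right].
Qed.

(* The normal monomial whose value in the model below is
   x^u d(x^c_1) .. d(x^c_r) for cs = [:: c_1; ..; c_r], where r = m * N. *)
Fixpoint nft (m u : nat) (cs : seq nat) : ptree :=
  if m is m'.+1 then
    comb u (Node MuN (rcons (map word (take N.-1 cs))
                            (nft m' (nth 0%N cs N.-1) (drop N cs))))
  else word u.

(** The last condition excludes m = u = 0, where [nft] is the trivial tree although u + sumn cs is
    0. *)
Definition valid (m u : nat) (cs : seq nat) : bool :=
  [&& size cs == (m * N)%N, all (fun c => 0 < c)%N cs & (0 < m + u)%N].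

Lemma wf_comb k t : wf N (comb k t) = wf N t.
Proof. by elim: k => //= k ->; rewrite andbT. Qed.

(** The N-th exponent plays the role of u for the last input of the root; being positive, it keeps
    the remaining data valid even when m = 0. *)
Lemma valid_last m u cs : valid m.+1 u cs ->
  valid m (nth 0%N cs N.-1) (drop N cs) /\
  cs = rcons (take N.-1 cs) (nth 0%N cs N.-1) ++ drop N cs.
Proof.
case/and3P=> /eqP sz cs0 _; have szN : (N.-1 < size cs)%N by rewrite sz mulSn; lia.
have E : rcons (take N.-1 cs) (nth 0%N cs N.-1) = take N cs.
  by rewrite -take_nth // prednK //; lia.
split; last by rewrite E cat_take_drop.
rewrite /valid size_drop sz mulSn addKn eqxx /=.
have -> : all (fun c => 0 < c)%N (drop N cs).
  by move: cs0; rewrite -{1}[cs](cat_take_drop N) all_cat => /andP[].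
by have /(all_nthP 0%N)/(_ _ szN) := cs0; rewrite addn_gt0 orbC => ->.
Qed.

Lemma size_block (cs : seq nat) t m : size cs = (m.+1 * N)%N ->
  size (rcons (map word (take N.-1 cs)) t) = N.
Proof.
move=> sz; rewrite size_rcons size_map size_takel ?prednK //; first lia.
by rewrite sz mulSn; lia.
Qed.

Lemma leaves_nft m u cs : valid m u cs -> leaves (nft m u cs) = (u + sumn cs)%N.
Proof.
elim: m u cs => [|m IH] u cs.
  by case/and3P=> /nilP -> _ u0; rewrite /= leaves_word ?addn0.
move=> V; have [V' E] := valid_last V; case/and3P: V => _ cs0 _.
rewrite leaves_comb /= map_rcons sumn_rcons IH // leaves_words.
  by rewrite [in RHS]E sumn_cat sumn_rcons; lia.
by apply/allP => c /mem_take; apply: (allP cs0).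
Qed.

(** The tree of mu_N o_i (mu_2^(k) o_(k+1) mu_N): the leading term of mu_N o_i mu_N for k = 0, and
    of an adjoined relation for k > 0. *)
Definition nested (k i : nat) : ptree :=
  Node MuN (nseq i.-1 Leaf ++ comb k (corolla N MuN) :: nseq (N - i) Leaf).

(** For i = N only k = 0 occurs, since the last input of a normal monomial may be a comb of positive
    length ending in mu_N. *)
Definition lead (t : ptree) : Prop :=
  [\/ t = Node Mu2 [:: corolla N Mu2; Leaf],
      t = Node Mu2 [:: corolla N MuN; Leaf] |
      exists k i, [/\ (1 <= i <= N)%N, k = 0%N \/ (i < N)%N &
        t = nested k i]].

Lemma lead_nested k i :
  (1 <= i <= N)%N -> k = 0%N \/ (i < N)%N -> lead (nested k i).
Proof. by move=> Hi Hk; apply: Or33; exists k, i. Qed.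

Lemma subtree_at_nseq n ts : all2 subtree_at (nseq n Leaf) ts = (size ts == n).
Proof. by elim: n ts => [|n IH] [|t ts] //=; rewrite IH. Qed.

Lemma subtree_at_corolla a ts : size ts = garity N a ->
  subtree_at (corolla N a) (Node a ts).
Proof. by move=> sz; rewrite /= eqxx subtree_at_nseq sz eqxx. Qed.

Lemma subtree_at_comb k t s : subtree_at t s -> subtree_at (comb k t) (comb k s).
Proof. by move=> ts; elim: k => //= k ->. Qed.

Lemma subtree_at_plug p q t ts : (p < size ts)%N ->
  all2 subtree_at (nseq p Leaf ++ t :: nseq q Leaf) ts =
  (size ts == p + q.+1)%N && subtree_at t (nth Leaf ts p).
Proof.
elim: p ts => [|p IH] [|u us] //= Hp; last by rewrite IH.
by rewrite subtree_at_nseq eqSS andbC.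
Qed.

Lemma divides_root t s : subtree_at t s -> divides t s.
Proof. by case: s => [|a ss] /= ->. Qed.

Lemma divides_child t a ss s : s \in ss -> divides t s -> divides t (Node a ss).
Proof. by move=> s_ss ts /=; apply/orP; right; apply/hasP; exists s. Qed.

Lemma nft_cat m u ws v ds : size ws = N.-1 -> nft m.+1 u (ws ++ v :: ds) =
  comb u (Node MuN (rcons (map word ws) (nft m v ds))).
Proof.
move=> sz; rewrite /= take_size_cat // nth_cat sz ltnn subnn /=.
rewrite drop_cat sz ifN; last lia.
have -> : (N - N.-1 = 1)%N by lia.
by rewrite /= drop0.
Qed.

(** By induction the inputs of the root are normal. Under mu_2, the first two leading terms force
    the left input to be a leaf, which lengthens the comb of the right input. Under mu_N, the trees
    [nested] force the first N - 1 inputs to be right combs and forbid mu_N at the root of the last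
    one. *)
Lemma nft_irreducible t : wf N t -> (forall s, lead s -> ~~ divides s t) ->
  exists m u cs, valid m u cs /\ t = nft m u cs.
Proof.
elim/ptree_ind': t => [|a ts IH] wf_t irr; first by exists 0%N, 1%N, [::].
have irr_child t : t \in ts -> forall s, lead s -> ~~ divides s t.
  by move=> t_ts s Ls; apply: contra (irr s Ls); apply: divides_child.
have {IH} nf t : t \in ts -> exists m u cs, valid m u cs /\ t = nft m u cs.
  move=> t_ts; have := irr_child t t_ts; have : wf N t.
    by case/andP: wf_t => _ /allP; apply.
  elim: ts t_ts IH {wf_t irr irr_child} => //= u us IHu.
  rewrite inE => /orP[/eqP -> []//|t_us [_ ?]]; exact: IHu.
have nomu2 s : lead s -> ~~ subtree_at s (Node a ts).
  by move=> Ls; apply: contra (irr s Ls); apply: divides_root.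
case: a wf_t nomu2 {irr irr_child} => wf_t nomu2.
  case: ts wf_t nf nomu2 => [|t1 [|t2 [|]]] //= /andP[wf1 /andP[wf2 _]] nf nomu2.
  case: t1 wf1 nf nomu2 => [|b ts] /= wf1 nf nomu2; last first.
    case/andP: wf1 => /eqP sz _; case: b sz nomu2 {nf} => sz nomu2.
      have /negP[] := nomu2 _ (Or31 _ _ erefl).
      by rewrite -[subtree_at _ _]/(subtree_at (corolla N Mu2) (Node Mu2 ts) && true)
                 subtree_at_corolla.
    have /negP[] := nomu2 _ (Or32 _ _ erefl).
      by rewrite -[subtree_at _ _]/(subtree_at (corolla N MuN) (Node MuN ts) && true)
                 subtree_at_corolla.
  have [|m [u [cs [V ->]]]] := nf t2; first by rewrite !inE eqxx orbT.
  exists m, u.+1, cs; split; first by case/and3P: V => H1 H2 _; rewrite /valid H1 H2 addnS.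
  by case: m V => //=; case: u => //= /and3P[_ _].
case/andP: wf_t => /eqP /= sz wf_ts.
have nf_word i : (i < N.-1)%N -> exists c, (0 < c)%N /\ nth Leaf ts i = word c.
  move=> Hi; have Hs : (i < size ts)%N by lia.
  have [m [u [cs [V E]]]] := nf _ (mem_nth Leaf Hs).
  (* If this input contained mu_N, it would begin with a comb of length u ending in mu_N, an
     occurrence of [nested u i.+1]. *)
  case: m V E => [|m] V E; first by case/and3P: V => _ _ u0; exists u.
  have /negP[] : ~~ subtree_at (nested u i.+1) (Node MuN ts).
    by apply/nomu2/lead_nested; [lia | right; lia].
  rewrite /nested /= -/(comb _ _) -/(corolla _ _).
  rewrite subtree_at_plug // E subtree_at_comb ?andbT; first by apply/eqP; lia.
  by apply: subtree_at_corolla; case/and3P: V => /eqP szc _ _; rewrite (size_block _ szc).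
have HN : (N.-1 < size ts)%N by lia.
have [m [v [ds [V E]]]] := nf _ (mem_nth Leaf HN).
have v0 : (0 < v)%N.
  case: m V E => [|m] V E; first by case/and3P: V.
  case: v V E => // V E.
  have /negP[] : ~~ subtree_at (nested 0 N) (Node MuN ts).
    by apply/nomu2/lead_nested; [lia | left].
  rewrite /nested /= -/(corolla _ _).
  rewrite subtree_at_plug // E subnn; apply/andP; split; first by apply/eqP; lia.
  by apply: subtree_at_corolla; case/and3P: V => /eqP szc _ _; rewrite (size_block _ szc).
pose ws := map leaves (take N.-1 ts).
have sz_ws : size ws = N.-1 by rewrite size_map size_takel // -ltnS; lia.
have tsE : ts = rcons (map word ws) (nft m v ds).
  apply: (@eq_from_nth _ Leaf) => [|i Hi]; first by rewrite size_rcons size_map; lia.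
  rewrite nth_rcons size_map sz_ws; case: ltngtP => Hi'; last 2 first.
  - by lia.
  - by rewrite Hi'.
  have [c [c0 Ec]] := nf_word i Hi'.
  rewrite (nth_map 0%N) ?sz_ws // /ws (nth_map Leaf) ?size_takel //; try lia.
  by rewrite nth_take // Ec leaves_word.
have ws0 : all (fun c => 0 < c)%N ws.
  rewrite all_map; apply/allP => t /mem_take /(allP wf_ts); exact: leaves_gt0.
exists m.+1, 0%N, (rcons ws v ++ ds); split.
  case/and3P: V => /eqP szd d0 _; apply/and3P; split=> //.
    by apply/eqP; rewrite size_cat size_rcons sz_ws szd; lia.
  by rewrite all_cat all_rcons v0 ws0.
by rewrite cat_rcons nft_cat // tsE.
Qed.

Lemma nft_head m u cs : valid m u cs -> exists w p,
  paths (nft m u cs) = w :: p /\ ((size w <= 1)%N \/ exists b, w = [:: MuN; b]).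
Proof.
case: m => [|m] V; first by case: u V => [|[|u]] _ /=; do 2!eexists; split; eauto.
case: u V => [|u] V; last by do 2!eexists; split; [reflexivity | left].
case/and3P: V => /eqP sz _ _ /=.
case: cs sz => [|c cs] sz; first by move: sz => /=; lia.
have -> : N.-1 = N.-2.+1 by lia.
case: c {sz} => [|[|c]] /=; do 2!eexists; (split; first reflexivity); try by left.
by right; exists Mu2.
Qed.

(** The first leaf decides: on the right its path starts with mu_2 and has length at least 2, which
    beats a path of length at most 1 and also mu_N b, as mu_2 > mu_N. *)
Lemma tree_lt_nft_mu2 m u cs a ss s : valid m u cs ->
  wf N (Node Mu2 [:: Node a ss; s]) ->
  leaves (nft m u cs) = leaves (Node Mu2 [:: Node a ss; s]) ->
  tree_lt (nft m u cs) (Node Mu2 [:: Node a ss; s]).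
Proof.
move=> V wf_t /tree_lt_leaves ->; case/and3P: wf_t => _ wf1 _.
have [w [p [-> w_small]]] := nft_head V.
case: ss wf1 => [|t ss] /andP[/eqP sz].
  by have := garity_gt1 a; rewrite -sz.
case/andP=> /leaves_gt0; rewrite -size_paths /=; case: (paths t) => //= q qs _ _.
apply/orP; left; rewrite /word_lt /=.
by case: w_small => [w1|[b ->]]; [rewrite ltnS (leq_trans w1) | case: (size q)].
Qed.

(** For m = 0 the normal monomial is [word v] itself, and [s] is a different tree. Otherwise its
    first v leaves already exceed those of [word v], and those of [s] are not smaller. *)
Lemma nft_first_block m v ds s : valid m v ds -> (0 < v)%N -> wf N s ->
  leaves s = leaves (nft m v ds) -> s <> word (leaves s) ->
  tree_le (nft m v ds) s -> paths_lt (paths (word v)) (take v (paths s)).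
Proof.
move=> V v0 wf_s Ls s_word; have := leaves_nft V; rewrite -Ls => Ls'.
case: m V Ls => [|m] V Ls.
  case/orP=> [/eqP E|]; first by case: s_word; rewrite Ls -E /= leaves_word.
  have -> : take v (paths s) = paths s.
    by rewrite take_oversize // size_paths Ls /= leaves_word.
  by rewrite tree_lt_leaves.
case/orP=> [/eqP <-|]; first exact: paths_word_comb.
rewrite tree_lt_leaves // => lt_s.
have [|<-|lt_take] := lex_lt_take v _ lt_s; first by rewrite !size_paths.
  exact: paths_word_comb.
exact: paths_lt_trans (paths_word_comb _ v0) lt_take.
Qed.

End Trees.

(** * Evaluation of tree monomials in a differential superalgebra *)

Section LinearExtension.

Context (K : fieldType) (T : choiceType) (V : lmodType K).

Definition lext (F : T -> V) (f : {malg K[T]}) : V :=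
  \sum_(k <- msupp f) f@_k *: F k.

Lemma lextEw (F : T -> V) (D : {fset T}) f : (msupp f `<=` D)%fset ->
  lext F f = \sum_(k <- D) f@_k *: F k.
Proof.
move=> le_fD; apply: big_fset_incl => // k _ /mcoeff_outdom ->.
by rewrite scale0r.
Qed.

Lemma lext_is_linear (F : T -> V) : linear (lext F).
Proof.
move=> a f g.
rewrite (@lextEw F (msupp f `|` msupp g)%fset (a *: f + g)).
  rewrite (lextEw _ (fsubsetUl _ (msupp g))) (lextEw _ (fsubsetUr (msupp f) _)).
  rewrite scaler_sumr -big_split; apply: eq_bigr => k _ /=.
  by rewrite mcoeffD mcoeffZ scalerDl scalerA.
apply: fsubset_trans (msuppD_le _ _) _.
exact: fsetSU (msuppZ_le _ _).
Qed.

HB.instance Definition _ F :=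
  GRing.isLinear.Build K {malg K[T]} V _ (lext F) (lext_is_linear F).

Lemma lextU F c k : lext F << c *g k >> = c *: F k.
Proof. by rewrite (lextEw _ (@msuppU_le _ _ k c)) big_seq_fset1 mcoeffUU. Qed.

Lemma eq_lext (F G : T -> V) f :
  (forall k, k \in msupp f -> F k = G k) -> lext F f = lext G f.
Proof. by move=> FG; apply: eq_big_seq => k /FG ->. Qed.

Lemma lext_eq0 (F : T -> V) f :
  (forall k, k \in msupp f -> F k = 0) -> lext F f = 0.
Proof. by move=> F0; apply: big1_seq => k /andP[_ /F0 ->]; rewrite scaler0. Qed.

Lemma scaleU (a c : K) (k : T) : a *: << c *g k >> = << a * c *g k >>.
Proof. by apply/malgP => l; rewrite mcoeffZ !mcoeffU mulrnAr. Qed.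

Lemma malg_ind (P : {malg K[T]} -> Prop) :
  (forall c k f, P f -> P (<< c *g k >> + f)) -> P 0 -> forall f, P f.
Proof.
move=> PD P0 f; rewrite [f]monalgE.
by elim/big_rec: _ => // k g _; apply: PD.
Qed.

End LinearExtension.

Lemma linear_lext (K : fieldType) (T : choiceType) (V W : lmodType K)
    (h : V -> W) (F : T -> V) f : linear h -> h (lext F f) = lext (h \o F) f.
Proof.
move=> h_lin; have h0 : h 0 = 0.
  by have := GRing.scalable_linear h_lin 0 0; rewrite /= !scale0r.
rewrite /lext; elim/big_rec2: _ => // k v w _ <-; exact: h_lin.
Qed.

Lemma lext_exchange (K : fieldType) (S T : choiceType) (V : lmodType K)
    (F : S -> T -> V) (f : {malg K[S]}) (g : {malg K[T]}) :
  lext (fun s => lext (F s) g) f = lext (fun t => lext (F^~ t) f) g.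
Proof.
rewrite /lext; under eq_bigr do rewrite scaler_sumr.
rewrite exchange_big; apply: eq_bigr => t _; rewrite scaler_sumr.
by apply: eq_bigr => s _; rewrite !scalerA mulrC.
Qed.

(** * Composition in the free operad as a bilinear operation *)

Section FreeOperadComposition.

Context (K : fieldType) (N : nat).

(** As an iterated linear extension, composition is visibly bilinear and can be exchanged with
    linear maps. *)
Lemma opcompE (f : {malg K[ptree]}) i g : opcomp N f i g =
  lext (fun s => lext (fun t =>
    << (-1) ^ (tdeg N t * rdeg N s i) *g graft s i t >>) g) f.
Proof.
rewrite /opcomp /lext; apply: eq_bigr => s _; rewrite scaler_sumr.
by apply: eq_bigr => t _; rewrite scalerA scaleU.
Qed.

Lemma wf_graft s i t : wf N s -> wf N t -> wf N (graft s i t).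
Proof.
move=> + wf_t; elim/ptree_ind': s i => [//|a ss IH] i /= /andP[/eqP <- wf_ss].
apply/andP; split.
  apply/eqP; elim: ss i {IH wf_ss} => //= u us IHu i.
  by case: ifP => //= _; rewrite IHu.
elim: ss IH i wf_ss => //= u us IHus [IHu IHl] i /andP[wf_u wf_us].
by case: ifP => /= _; [rewrite IHu | rewrite wf_u IHus].
Qed.

Lemma component_linear n c (f g : {malg K[ptree]}) :
  component N n f -> component N n g -> component N n (c *: f + g).
Proof.
move=> cf cg t /(fsubsetP (msuppD_le _ _)).
by rewrite in_fsetU => /orP[/(fsubsetP (msuppZ_le _ _))/cf | /cg].
Qed.

Lemma component0 n : @component K N n 0.
Proof. by move=> t; rewrite msupp0. Qed.

Lemma component_lext (T : choiceType) n (F : T -> {malg K[ptree]}) f :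
  (forall k, k \in msupp f -> component N n (F k)) -> component N n (lext F f).
Proof.
move=> cF; rewrite /lext big_seq_cond; elim/big_ind: _ => [|g h cg ch|k].
- exact: component0.
- by rewrite -[g]scale1r; apply: component_linear.
rewrite andbT => /cF ck; rewrite -[_ *: _]addr0.
exact: component_linear (component0 _).
Qed.

Lemma componentU n c t : wf N t -> leaves t = n ->
  component N n (<< c *g t >> : {malg K[ptree]}).
Proof.
by move=> wf_t Lt s /(fsubsetP msuppU_le); rewrite in_fset1 => /eqP ->.
Qed.

Lemma component_opcomp n m (f : {malg K[ptree]}) i g : (1 <= i <= n)%N ->
  component N n f -> component N m g ->
  component N (n + m - 1)%N (opcomp N f i g).
Proof.
move=> Hi cf cg; rewrite opcompE.
apply: component_lext => s /cf [wf_s Ls]; apply: component_lext => t /cg [wf_t Lt].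
by apply: componentU; [apply: wf_graft | rewrite leaves_graft Ls // Lt].
Qed.

Lemma deg_partE d (f : {malg K[ptree]}) :
  deg_part N d f = lext (fun t => if tdeg N t == d then << t >> else 0) f.
Proof.
rewrite /deg_part big_mkcond; apply: eq_bigr => t _.
by case: eqP => _; rewrite ?scaler0 // scaleU mulr1.
Qed.

Lemma component_deg_part n d (f : {malg K[ptree]}) :
  component N n f -> component N n (deg_part N d f).
Proof.
move=> cf; rewrite deg_partE; apply: component_lext => t /cf [wf_t Lt].
by case: eqP => _; [apply: componentU | apply: component0].
Qed.

Lemma sumn_leaves_nseq n : sumn (map leaves (nseq n Leaf)) = n.
Proof. by elim: n => //= n ->. Qed.

Lemma leaves_corolla a : leaves (corolla N a) = garity N a.
Proof. exact: sumn_leaves_nseq. Qed.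

Lemma wf_corolla a : wf N (corolla N a).
Proof. by rewrite /= size_nseq eqxx; elim: (garity N a). Qed.

Lemma sum_tdeg_nseq n : foldr +%R 0 (map (tdeg N) (nseq n Leaf)) = 0 :> int.
Proof. by elim: n => //= n ->. Qed.

Lemma tdeg_corolla a : tdeg N (corolla N a) = gdeg N a.
Proof. by rewrite /= sum_tdeg_nseq addr0. Qed.

Lemma rdeg_corolla a j : rdeg N (corolla N a) j = 0.
Proof.
rewrite /corolla /=; elim: (garity N a) j => //= n IH j.
by case: ifP => _ //; rewrite sum_tdeg_nseq.
Qed.

End FreeOperadComposition.


(** * A square-zero superderivation and the evaluation of trees *)

Section SuperDerivation.

(** The family [theta] encodes a grading of A, with [theta c] standing for multiplication by c^k on
    elements of degree k; [theta_D] places D in degree 1. *)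
Context (K : fieldType) (A : lalgType K) (D : A) (theta : K -> {linear A -> A}).
Context (scale_mulr : forall c (a b : A), c *: (a * b) = a * (c *: b)).
Context (theta_mul : forall c a b, theta c (a * b) = theta c a * theta c b).
Context (theta_one : forall c, theta c 1 = 1).
Context (theta1 : forall a, theta 1 a = a).
Context (thetaM : forall c c' a, theta c (theta c' a) = theta (c * c') a).
Context (theta_D : forall c, theta c D = c *: D).
Context (DDC : forall a, D * D * a = a * (D * D)).

(* The supercommutator with D, as theta (-1) is the parity automorphism. *)
Definition dd (a : A) : A := D * a - theta (-1) a * D.

Lemma dd_is_linear : linear dd.
Proof.
move=> c a b; rewrite /dd linearP mulrDl mulrDr -scale_mulr -scalerAl scalerBr.
by rewrite opprD addrACA.
Qed.

HB.instance Definition _ := GRing.isLinear.Build K A A _ dd dd_is_linear.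

Lemma dd_mul a b : dd (a * b) = dd a * b + theta (-1) a * dd b.
Proof.
rewrite /dd theta_mul mulrBl mulrBr !mulrA.
by rewrite addrA subrK.
Qed.

Lemma theta_dd c a : theta c (dd a) = c *: dd (theta c a).
Proof.
rewrite /dd linearB !theta_mul theta_D !thetaM -scale_mulr -scalerAl scalerBr.
by rewrite [c * -1]mulrC.
Qed.

(** In the expansion the two terms D [theta (-1) a] D cancel, and D D a - a D D vanishes as D D is
    central. *)
Lemma dd_dd a : dd (dd a) = 0.
Proof.
rewrite {1}/dd theta_dd scaleN1r /dd thetaM mulrNN mulr1 theta1.
by rewrite mulNr opprK mulrBr mulrBl !mulrA -[a * _ * _]mulrA -DDC addrA
           subrK subrr.
Qed.

Lemma dd1 : dd 1 = 0.
Proof. by rewrite /dd theta_one mulr1 mul1r subrr. Qed.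

Context (N : nat).

Local Notation sg x := ((-1 : K) ^ x).

Lemma sg_neq0 (p : int) : sg p != 0.
Proof. by rewrite expfz_neq0 // oppr_eq0 oner_eq0. Qed.

Lemma sg_sq (p : int) : sg p * sg p = 1.
Proof. by rewrite -expfzMl mulrNN mulr1 exp1rz. Qed.

Lemma sgM (p q : int) : sg p ^ q = sg (p * q).
Proof. by rewrite exprz_exp. Qed.

Lemma sg_arity p : sg (p * (2 - N%:Z)) = sg p ^+ N.
Proof.
have -> : p * (2 - N%:Z) = p * N%:Z + (p * (1 - N%:Z) + p * (1 - N%:Z)) by ring.
by rewrite -sgD -[sg (_ + _)]sgD sg_sq mulr1 -sgM.
Qed.

Definition tw (p : int) : {linear A -> A} := theta (sg p).

Lemma twD p q a : tw (p + q) a = tw p (tw q a).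
Proof. by rewrite /tw thetaM sgD. Qed.

Lemma tw0 a : tw 0 a = a.
Proof. by rewrite /tw expr0z theta1. Qed.

(* The operation on the input of a vertex with k inputs to its right; for MuN the
   exponent of theta is the Koszul sign of moving D past the other inputs. *)
Definition slot (a : gen) (k : nat) (v : A) : A :=
  if a is Mu2 then v else dd (tw k v).

Lemma slot_is_linear a k : linear (slot a k).
Proof. by case: a => c u v //=; rewrite !linearP. Qed.

HB.instance Definition _ a k :=
  GRing.isLinear.Build K A A _ (slot a k) (slot_is_linear a k).

Fixpoint ev (t : ptree) (X : nat -> A) : A :=
  match t with
  | Leaf => X 1
  | Node a ts =>
    (fix evs ts X :=
      if ts is t :: ts' then
        slot a (size ts') (ev t X) * evs ts' (fun j => X (j + leaves t)%N)
      else 1) ts X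
  end.

(** The inner fixpoint of [ev] under a name, so that induction on the list of inputs can be
    stated. *)
Definition evs (a : gen) :=
  fix evs (ts : seq ptree) (X : nat -> A) : A :=
    if ts is t :: ts' then
      slot a (size ts') (ev t X) * evs ts' (fun j => X (j + leaves t)%N)
    else 1.

Lemma ev_node a ts X : ev (Node a ts) X = evs a ts X.
Proof. by []. Qed.

Lemma ev_ext t X Y : (forall j, (1 <= j <= leaves t)%N -> X j = Y j) ->
  ev t X = ev t Y.
Proof.
elim/ptree_ind': t X Y => [|a ts IH] X Y XY; first exact: XY.
rewrite !ev_node; elim: ts IH X Y XY => [|t ts IHts] //= [IHt IHl] X Y XY.
congr (slot _ _ _ * _); first by apply: IHt => j Hj; apply: XY; rewrite /=; lia.
by apply: IHts => // j /= Hj; apply: XY => /=; lia.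
Qed.

Lemma evs_ext a ts X Y :
  (forall j, (1 <= j <= sumn (map leaves ts))%N -> X j = Y j) ->
  evs a ts X = evs a ts Y.
Proof. exact: (@ev_ext (Node a ts)). Qed.

Lemma tw_slot p a k v :
  tw p (slot a k v) = (sg p) ^+ (a == MuN) *: slot a k (tw p v).
Proof.
case: a => /=; first by rewrite scale1r.
by rewrite /tw theta_dd !thetaM [sg p * _]mulrC expr1.
Qed.

(** Each mu_N applies [dd], of degree 1, to N inputs, while it counts 2 - N in [tdeg]; the two
    numbers have the same parity. *)
Lemma tw_ev p t X : wf N t ->
  tw p (ev t X) = sg (p * tdeg N t) *: ev t (fun j => tw p (X j)).
Proof.
elim/ptree_ind': t X => [|a ts IH] X; first by rewrite mulr0 expr0z scale1r.
rewrite !ev_node /= => /andP[/eqP sz_ts wf_ts].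
have {sz_ts} -> : sg (p * (gdeg N a + foldr +%R 0 (map (tdeg N) ts))) =
    (sg p ^+ (a == MuN)) ^+ size ts * sg (p * foldr +%R 0 (map (tdeg N) ts)).
  rewrite mulrDr -sgD; congr (_ * _); rewrite sz_ts; case: a {IH sz_ts} => /=.
    by rewrite mulr0 expr0z expr1n.
  by rewrite expr1 sg_arity.
elim: ts IH wf_ts X => [|t ts IHts] /= [].
  by move=> _ X; rewrite mulr0 expr0z mulr1 expr0 scale1r /tw theta_one.
move=> IHt IHl /andP[wf_t wf_ts] X.
rewrite {1}/tw theta_mul -!/(tw p) tw_slot IHt // linearZ /= IHts //.
rewrite -!scalerAl -!scale_mulr !scalerA; congr (_ *: _).
by rewrite mulrDr -sgD exprS; ring.
Qed.

(** No sign appears: for [ev] grafting is plain substitution, and signs arise only when [evt] twists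
    the arguments. *)
Lemma ev_graft s i t X : (1 <= i <= leaves s)%N ->
  ev (graft s i t) X =
  ev s (fun j => if (j < i)%N then X j
                 else if j == i then ev t (fun k => X (k + i - 1)%N)
                 else X (j + leaves t - 1)%N).
Proof.
elim/ptree_ind': s i X => [|a ss IH] i X Hi.
  have -> : i = 1%N by move: Hi => /=; lia.
  by apply: ev_ext => j Hj /=; congr X; lia.
rewrite [RHS]ev_node /=.
elim: ss i X IH Hi => [|u us IHs] i X /= []; first lia.
move=> IHu IHus Hi; case: leqP => Hu /=.
  rewrite IHu; last lia.
  congr (_ * _); apply: evs_ext => j Hj /=.
  rewrite leaves_graft; last lia.
  rewrite !ifN; try lia.
  by congr X; lia.
congr (slot _ _ _ * _).
- move: (i - leaves u)%N => m; elim: us m {Hi IHs IHus} => //= v vs IHv m.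
  by case: ifP => //= _; rewrite IHv.
- by apply: ev_ext => j Hj; rewrite ifT //; lia.
rewrite IHs //; last by rewrite /=; lia.
apply: evs_ext => j Hj.
have -> : (j + leaves u < i)%N = (j < i - leaves u)%N by lia.
have -> : (j + leaves u == i)%N = (j == i - leaves u)%N by lia.
case: ifP => // H1; case: ifP => H2; last by congr X; lia.
by apply: ev_ext => k Hk; congr X; lia.
Qed.

Lemma ev_linear t i X : (1 <= i <= leaves t)%N ->
  linear (fun v => ev t (fun j => if j == i then v else X j)).
Proof.
move=> Hi c v w; elim/ptree_ind': t i X Hi => [|a ts IH] i X Hi.
  by have -> : i = 1%N by move: Hi => /=; lia.
rewrite !ev_node; elim: ts i X IH Hi => [|u us IHs] i X /= []; first lia.
move=> IHu IHus Hi; case: (leqP i (leaves u)) => Hu.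
  rewrite IHu; last lia.
  rewrite linearP mulrDl -scalerAl.
  by congr (_ *: (_ * _) + _ * _); apply: evs_ext => j Hj; rewrite !ifN //; lia.
have evE x : evs a us (fun j => if j + leaves u == i then x else X (j + leaves u))%N
    = evs a us (fun j => if j == i - leaves u then x else X (j + leaves u))%N.
  by apply: evs_ext => j Hj; congr (if _ then _ else _); lia.
rewrite !evE IHs //; last by rewrite /=; lia.
rewrite mulrDr -scale_mulr.
by congr (_ *: (slot _ _ _ * _) + slot _ _ _ * _);
   apply: ev_ext => j Hj; rewrite !ifN //; lia.
Qed.

(* The arguments are twisted because, in the convention of [opcomp], the
   vertices to the right of a leaf are moved across its argument. *)
Definition evt (t : ptree) (X : nat -> A) : A :=
  ev t (fun j => tw (rdeg N t j) (X j)).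

(** The arguments seen by s in a composite s o_i t, where t has degree p and l leaves: the value v
    of t fills the i-th place, and the arguments before it carry the Koszul sign of moving t across
    them. *)
Definition plug (p : int) (i : nat) (v : A) (l : nat) (X : nat -> A) : nat -> A :=
  fun j => if (j < i)%N then tw p (X j)
           else if j == i then v else X (j + l - 1)%N.

(** Evaluation turns composition into substitution, sign included. Pulling the twist by [rdeg N s i]
    out of the value of t costs exactly the sign of [opcomp]; a leaf of s before the i-th one gains
    t on its right, whence the twist in [plug]. *)
Lemma evt_graft s i t X : (1 <= i <= leaves s)%N -> wf N t ->
  sg (tdeg N t * rdeg N s i) *: evt (graft s i t) X =
  evt s (plug (tdeg N t) i (evt t (fun k => X (k + i - 1)%N)) (leaves t) X).
Proof.
move=> Hi wf_t; rewrite /evt ev_graft //.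
set Y := fun j => _.
rewrite (@ev_ext s Y (fun j => if j == i then
   sg (tdeg N t * rdeg N s i) *: tw (rdeg N s i)
     (ev t (fun k => tw (rdeg N t k) (X (k + i - 1)%N))) else Y j)); last first.
  move=> j Hj; case: eqP => // ->; rewrite /Y ltnn eqxx tw_ev //.
  rewrite scalerA [tdeg N t * _]mulrC sg_sq scale1r; apply: ev_ext => k Hk.
  rewrite rdeg_nested; try lia.
  by rewrite [_ + rdeg N s i]addrC twD; congr (tw _ (tw (rdeg _ _ _) _)); lia.
rewrite (GRing.scalable_linear (ev_linear Y Hi)) scalerA sg_sq scale1r.
apply: ev_ext => j Hj; rewrite /plug; case: (ltngtP j i) => Hji.
- rewrite /Y Hji rdeg_left1 ?twD //; lia.
- rewrite /Y ifN; last lia.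
  by rewrite ifN; [rewrite -(@rdeg_left2 N s j i t) //; lia | lia].
- by rewrite Hji.
Qed.

Lemma evt_linear s i p l X : (1 <= i <= leaves s)%N ->
  linear (fun v => evt s (plug p i v l X)).
Proof.
move=> Hi c v w; rewrite /evt.
pose Y j := tw (rdeg N s j) (plug p i 0 l X j).
have E x : ev s (fun j => tw (rdeg N s j) (plug p i x l X j)) =
           ev s (fun j => if j == i then tw (rdeg N s i) x else Y j).
  apply: ev_ext => j Hj; rewrite /Y /plug.
  by case: (ltngtP j i) => // ->.
by rewrite !E linearP; apply: (ev_linear Y Hi).
Qed.

(** Degrees are evaluated separately because ideals are graded and because the twist in [plug]
    depends on the degree of the inner tree. *)
Definition eval_deg (d : int) (X : nat -> A) : {malg K[ptree]} -> A :=
  lext (fun t => if tdeg N t == d then evt t X else 0).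

HB.instance Definition _ d X := GRing.Linear.on (eval_deg d X).

(** * The ideal of elements all of whose values are zero *)

Definition killed (n : nat) (f : {malg K[ptree]}) : Prop :=
  component N n f /\ forall d X, eval_deg d X f = 0.

Lemma eval_deg_graft d X s i t : (1 <= i <= leaves s)%N -> wf N t ->
  eval_deg d X << sg (tdeg N t * rdeg N s i) *g graft s i t >> =
  if tdeg N s + tdeg N t == d then
    evt s (plug (tdeg N t) i (evt t (fun k => X (k + i - 1)%N)) (leaves t) X)
  else 0.
Proof.
move=> Hi wf_t; rewrite /eval_deg lextU tdeg_graft //.
by case: eqP => _; rewrite ?scaler0 // evt_graft.
Qed.

Lemma eval_deg_opcomp d X f i g n m : component N n f -> component N m g ->
  (1 <= i <= n)%N ->
  eval_deg d X (opcomp N f i g) = lext (fun s => lext (fun t =>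
    if tdeg N s + tdeg N t == d then
      evt s (plug (tdeg N t) i (evt t (fun k => X (k + i - 1)%N)) m X)
    else 0) g) f.
Proof.
move=> cf cg Hi; rewrite opcompE (linear_lext _ _ (linearP _)).
apply: eq_lext => s /cf [_ Ls] /=.
rewrite [LHS](linear_lext _ _ (linearP _)).
apply: eq_lext => t /cg [wf_t Lt] /=.
by rewrite eval_deg_graft ?Ls // Lt.
Qed.

(** In f o_i g with f killed, a fixed monomial of g leaves a value of f at the arguments given by
    [plug]. With g killed, a fixed monomial of f has a value that is linear in its i-th argument,
    where a value of g stands. *)
Lemma killed_is_ideal : is_ideal N killed.
Proof.
split.
- by move=> n f [].
- by move=> n; split; [exact: component0 | move=> d X; rewrite linear0].
- move=> n c f g [cf kf] [cg kg]; split; first exact: component_linear.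
  by move=> d X; rewrite linearP /= kf kg scaler0 addr0.
- move=> n d f [cf kf]; split; first exact: component_deg_part.
  move=> e X; rewrite deg_partE (linear_lext _ _ (linearP _)).
  case: (eqVneq d e) => [<-|de]; last first.
    apply: lext_eq0 => t _ /=; case: eqP => [td|_]; last by rewrite linear0.
    by rewrite /eval_deg lextU td (negPf de) scaler0.
  rewrite -[RHS](kf d X); apply: eq_lext => t _ /=.
  case: eqP => td; last by rewrite linear0.
  by rewrite /eval_deg lextU td eqxx scale1r.
- move=> n m i f g Hi [cf kf] cg; split; first exact: component_opcomp.
  move=> d X; rewrite (eval_deg_opcomp _ _ cf cg Hi) lext_exchange.
  apply: lext_eq0 => t _.
  rewrite -[RHS](kf (d - tdeg N t)
    (plug (tdeg N t) i (evt t (fun k => X (k + i - 1)%N)) m X)).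
  by apply: eq_lext => s _; rewrite (eq_sym _ (d - _)) subr_eq eq_sym.
move=> n m i f g Hi cf [cg kg]; split; first exact: component_opcomp.
move=> d X; rewrite (eval_deg_opcomp _ _ cf cg Hi).
apply: lext_eq0 => s /cf [_ Ls].
have Hs : (1 <= i <= leaves s)%N by rewrite Ls.
have h_lin := @evt_linear s i (d - tdeg N s) m X Hs.
have h0 : evt s (plug (d - tdeg N s) i 0 m X) = 0.
  by have := GRing.scalable_linear h_lin 0 0; rewrite /= !scale0r.
rewrite -h0 -[in RHS](kg (d - tdeg N s) (fun k => X (k + i - 1)%N)).
rewrite [RHS](linear_lext _ _ h_lin); apply: eq_lext => t _ /=.
have -> : (tdeg N s + tdeg N t == d) = (tdeg N t == d - tdeg N s).
  by rewrite [RHS]eq_sym subr_eq addrC eq_sym.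
by case: eqP => [->|_].
Qed.

(** * The defining relations evaluate to zero *)

Lemma evt_corolla a X :
  evt (corolla N a) X = evs a (nseq (garity N a) Leaf) X.
Proof.
rewrite /evt ev_node; apply: evs_ext => j _.
by rewrite (rdeg_corolla N a) tw0.
Qed.

Local Notation nuN n X := (evs MuN (nseq n Leaf) X).

Lemma evs_mu2 X : evs Mu2 [:: Leaf; Leaf] X = X 1%N * X 2%N.
Proof. by rewrite /= mulr1. Qed.

Lemma eval_deg_corollas d X a b i : (1 <= i <= garity N a)%N ->
  eval_deg d X (opcomp N << corolla N a >> i << corolla N b >>) =
  if gdeg N a + gdeg N b == d then
    evs a (nseq (garity N a) Leaf) (plug (gdeg N b) i
      (evs b (nseq (garity N b) Leaf) (fun k => X (k + i - 1)%N)) (garity N b) X)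
  else 0.
Proof.
move=> Hi; rewrite opcomp1 eval_deg_graft ?leaves_corolla ?wf_corolla //.
by rewrite !tdeg_corolla !evt_corolla.
Qed.

Lemma eval_deg_star d X a b q l :
  eval_deg d X (star N (garity N a) << corolla N a >> l q << corolla N b >>) =
  if gdeg N a + gdeg N b == d then
    \sum_(1 <= i < (garity N a).+1)
      sg (q * ((garity N a)%:Z - 1) + (l%:Z - 1) * (i%:Z - 1)) *:
      evs a (nseq (garity N a) Leaf) (plug (gdeg N b) i
        (evs b (nseq (garity N b) Leaf) (fun k => X (k + i - 1)%N))
        (garity N b) X)
  else 0.
Proof.
rewrite /star linear_sum /=; case: ifP => dE; last first.
  rewrite big_nat big1 // => i Hi; rewrite linearZ /= eval_deg_corollas ?dE ?scaler0 //.
rewrite big_nat [RHS]big_nat; apply: eq_bigr => i Hi.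
by rewrite linearZ /= eval_deg_corollas ?dE.
Qed.

Lemma dd_muN n X : dd (nuN n X) = 0.
Proof.
elim: n X => [|n IH] X /=; first exact: dd1.
by rewrite dd_mul IH mulr0 addr0 dd_dd mul0r.
Qed.

Lemma dd_tw p a : dd a = 0 -> dd (tw p a) = 0.
Proof.
move=> da; have /(congr1 (fun v => (sg p)^-1 *: v)) := theta_dd (sg p) a.
by rewrite da linear0 scaler0 scalerA mulVf ?sg_neq0 // scale1r => <-.
Qed.

Lemma muN_eq0 n i X : (1 <= i <= n)%N -> dd (X i) = 0 -> nuN n X = 0.
Proof.
elim: n i X => [|n IH] i X Hi dX /=; first lia.
have [i1|i1] := eqVneq i 1%N.
  by rewrite i1 in dX; rewrite dd_tw ?mul0r.
by rewrite (IH i.-1) ?mulr0 //; [lia | rewrite addn1 prednK //; lia].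
Qed.

(* By Leibniz's rule the i-th summand is, up to its sign, the sum of two
   consecutive terms, so that only the two ends survive. *)
Lemma muN_leibniz n X :
  \sum_(1 <= i < n.+1) (-1) ^+ i.-1 *: nuN n (plug 0 i (X i * X i.+1) 2 X) =
  tw n (X 1%N) * nuN n (fun j => X j.+1) - (-1) ^+ n *: (nuN n X * X n.+1).
Proof.
elim: n X => [|n IH] X.
  by rewrite big_geq // /= mulr1 mul1r expr0 scale1r tw0 subrr.
pose X' j := X j.+1.
(* With the first factor split off, every later summand becomes a summand for the shifted arguments
   [X'], ready for the induction hypothesis. *)
have step i : (1 <= i < n.+1)%N ->
    (-1) ^+ i *: nuN n.+1 (plug 0 i.+1 (X i.+1 * X i.+2) 2 X) =
    - dd (tw n (X 1%N)) * ((-1) ^+ i.-1 *: nuN n (plug 0 i (X' i * X' i.+1) 2 X')).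
  move=> Hi; have -> : (-1) ^+ i = - (-1) ^+ i.-1 :> K.
    by case: i Hi => // i _; rewrite exprS mulN1r.
  rewrite scaleNr mulNr -scale_mulr /= size_nseq; congr (- (_ *: (_ * _))).
    by rewrite /plug ifT ?tw0 //; lia.
  apply: evs_ext => j Hj; rewrite /plug /X' addn1 ltnS eqSS.
  by case: ifP => // _; case: ifP => // _; congr X; lia.
rewrite big_nat_recl // expr0 scale1r.
rewrite big_nat [X in _ + X](eq_bigr _ step) -big_nat -mulr_sumr IH.
rewrite /= size_nseq /plug /= /X'.
rewrite (@evs_ext _ _ _ (fun j => X j.+2)); last first.
  by move=> j Hj; rewrite !ifN; [congr X; lia | lia | lia].
have -> : tw n (X 1%N * X 2%N) = tw n (X 1%N) * tw n (X 2%N) by apply: theta_mul.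
have -> : tw n.+1 (X 1%N) = theta (-1) (tw n (X 1%N)).
  by rewrite -addn1 PoszD addrC twD.
have Ex g h : g =1 h -> nuN n g = nuN n h by move=> gh; apply: evs_ext => j _; apply: gh.
rewrite (Ex (fun j => X (j + 1).+1) (fun j => X j.+2)); last by move=> j; rewrite addn1.
rewrite (Ex (fun j => X (j + 1)%N) (fun j => X j.+1)); last by move=> j; rewrite addn1.
(* Leibniz's rule splits the first summand in two: one term is the left end of the claim, the other
   cancels the left end of the induction hypothesis. *)
rewrite dd_mul mulrDl mulNr.
move: (tw n (X 2%N)) (nuN n _) (nuN n _) (dd (tw n (X 2%N))) (dd _) (theta _ _).
move=> u e1 e2 c b a; rewrite [b * (_ - _)]mulrBr -scale_mulr exprS -scalerA scaleN1r.
rewrite opprB opprK !mulrA [b * u * e2 + _]addrC -addrA.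
by rewrite [b * u * e2 + _]addrC subrK.
Qed.

Lemma Rel22_killed d X : eval_deg d X (star N 2 (mu2 K N) 2 0 (mu2 K N)) = 0.
Proof.
rewrite [LHS](eval_deg_star d X Mu2 Mu2 0 2) /=; case: eqP => // _.
rewrite big_ltn // big_nat1 /plug /= !mulr1 tw0 !add0r subrr mulr0 expr0z scale1r.
by rewrite [(-1) ^ _](_ : _ = -1) // scaleN1r mulrA subrr.
Qed.

Lemma Rel2N_killed d X : eval_deg d X
  (star N 2 (mu2 K N) N (2 - N%:Z) (muN K N) +
   star N N (muN K N) 2 0 (mu2 K N)) = 0.
Proof.
rewrite linearD.
rewrite [X in X + _](eval_deg_star d X Mu2 MuN (2 - N%:Z) N).
rewrite [X in _ + X](eval_deg_star d X MuN Mu2 0 2).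
rewrite [gdeg N Mu2 + _]addrC; case: eqP => [_|_]; last by rewrite addr0.
have -> : \sum_(1 <= i < (garity N MuN).+1)
      sg (0 * ((garity N MuN)%:Z - 1) + (2%:Z - 1) * (i%:Z - 1)) *:
      nuN (garity N MuN) (plug (gdeg N Mu2) i
        (evs Mu2 (nseq (garity N Mu2) Leaf) (fun k => X (k + i - 1)%N))
        (garity N Mu2) X) =
   tw N (X 1%N) * nuN N (fun j => X j.+1) - (-1) ^+ N *: (nuN N X * X N.+1).
  rewrite -muN_leibniz big_nat [RHS]big_nat; apply: eq_bigr => i Hi.
  rewrite mul0r add0r mul1r; congr (_ *: _).
    by rewrite exprnP; congr (_ ^ _); lia.
  apply: evs_ext => j _; rewrite evs_mu2 /plug; case: ifP => // _; case: ifP => // _.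
  by congr (X _ * X _); lia.
rewrite big_ltn // big_nat1 !evs_mu2 /plug /= mulr1.
(* In the form required by [sg_arity], the sign of mu_2 o_1 mu_N is (-1)^N; that of mu_2 o_2 mu_N is
   -1. *)
have -> : 2 - N%:Z + (N%:Z - 1) * (1 - 1) = 1 * (2 - N%:Z) by ring.
have -> : 2 - N%:Z + (N%:Z - 1) * (2%:Z - 1) = 1 by ring.
have -> : tw (2 - N%:Z) (X 1%N) = tw N (X 1%N).
  by rewrite /tw -[2 - _]mul1r sg_arity.
have Ex g h : (forall j, (0 < j)%N -> g j = h j) -> nuN N g = nuN N h.
  by move=> gh; apply: evs_ext => j /andP[j0 _]; apply: gh.
rewrite (Ex _ X); last by move=> j _; rewrite addnK.
rewrite (Ex (fun k => X (k + 2 - 1)%N) (fun j => X j.+1)); last first.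
  by move=> j _; rewrite addn2 subn1.
rewrite sg_arity expr1z scaleN1r (_ : (2 + N - 1)%N = N.+1); last lia.
by rewrite addrA subrK subrr.
Qed.

Lemma RelNN_killed i d X : (1 <= i <= N)%N ->
  eval_deg d X (opcomp N (muN K N) i (muN K N)) = 0.
Proof.
move=> Hi; rewrite [LHS](@eval_deg_corollas d X MuN MuN i Hi).
case: eqP => // _; apply: (muN_eq0 Hi).
by rewrite /plug ltnn eqxx dd_muN.
Qed.

Lemma defining_killed n f :
  defining_relation N f -> component N n f -> killed n f.
Proof.
move=> Rf cf; split=> // d X; case: Rf => [||i Hi].
- exact: Rel22_killed.
- exact: Rel2N_killed.
- exact: RelNN_killed.
Qed.

Lemma ideal_killed n f : ideal_generated N (@defining_relation K N) n f ->
  forall d X, eval_deg d X f = 0.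
Proof.
move=> If; apply: (If _ killed_is_ideal _).2 => m g; exact: defining_killed.
Qed.

(** * Linear spans and the values of monomials at x *)

Inductive lspan (S : A -> Prop) : A -> Prop :=
  | Span0 : lspan S 0
  | SpanD c b a : S b -> lspan S a -> lspan S (c *: b + a).

Lemma span_gen (S : A -> Prop) b : S b -> lspan S b.
Proof. by move=> Sb; rewrite -[b]addr0 -[b]scale1r; apply/SpanD/Span0. Qed.

Lemma span_lin (S : A -> Prop) c a b :
  lspan S a -> lspan S b -> lspan S (c *: a + b).
Proof.
move=> Sa Sb; elim: Sa => [|d g e Sg _ IH]; first by rewrite scaler0 add0r.
by rewrite scalerDr scalerA -addrA; apply: SpanD.
Qed.

Lemma spanZ (S : A -> Prop) c a : lspan S a -> lspan S (c *: a).
Proof. by move=> Sa; rewrite -[_ *: _]addr0; apply: span_lin (Span0 S). Qed.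

Lemma span_map (S S' : A -> Prop) (h : A -> A) a : linear h ->
  (forall b, S b -> lspan S' (h b)) -> lspan S a -> lspan S' (h a).
Proof.
move=> h_lin Sh; elim=> [|c b e Sb _ IH].
  by have := GRing.scalable_linear h_lin 0 0; rewrite /= !scale0r => ->; apply: Span0.
by rewrite h_lin; apply: span_lin => //; apply: Sh.
Qed.

Lemma span_sub (S S' : A -> Prop) a :
  (forall b, S b -> S' b) -> lspan S a -> lspan S' a.
Proof. by move=> SS'; apply: (@span_map _ _ id) => // b /SS'/span_gen. Qed.

Lemma span_mul (S S' S'' : A -> Prop) a b :
  (forall a b, S a -> S' b -> lspan S'' (a * b)) ->
  lspan S a -> lspan S' b -> lspan S'' (a * b).
Proof.
move=> SS Sa Sb; apply: (@span_map S _ (fun a => a * b)) Sa.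
  by move=> c u v; rewrite mulrDl scalerAl.
move=> u Su; apply: (@span_map S' _ (fun b => u * b)) Sb => [c v w|v Sv].
  by rewrite mulrDr scale_mulr.
exact: SS.
Qed.

Context (hN : (3 <= N)%N) (x : A) (theta_x : forall c, theta c x = x).

Lemma theta_xpow c n : theta c (x ^+ n) = x ^+ n.
Proof.
elim: n => [|n IH]; first by rewrite expr0 theta_one.
by rewrite exprS theta_mul theta_x IH.
Qed.

Definition value (t : ptree) : A := ev t (fun _ => x).

Definition forms (cs : seq nat) : A := \prod_(c <- cs) dd (x ^+ c).
Definition basis (u : nat) (cs : seq nat) : A := x ^+ u * forms cs.

Lemma forms_cons c cs : forms (c :: cs) = dd (x ^+ c) * forms cs.
Proof. exact: big_cons. Qed.

Lemma forms_cat cs ds : forms (cs ++ ds) = forms cs * forms ds.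
Proof. exact: big_cat. Qed.

Lemma dd_forms cs : dd (forms cs) = 0.
Proof.
elim: cs => [|c cs IH]; first by rewrite /forms big_nil dd1.
by rewrite forms_cons dd_mul IH mulr0 addr0 dd_dd mul0r.
Qed.

Lemma dd_basis u cs : dd (basis u cs) = forms (u :: cs).
Proof. by rewrite dd_mul dd_forms mulr0 addr0 forms_cons. Qed.

Lemma tw_basis p u cs : tw p (basis u cs) = sg p ^+ size cs *: basis u cs.
Proof.
rewrite /tw theta_mul theta_xpow /basis scale_mulr; congr (_ * _).
elim: cs => [|c cs IH]; first by rewrite /forms big_nil theta_one scale1r.
rewrite forms_cons theta_mul IH theta_dd theta_xpow -scalerAl -scale_mulr scalerA.
by rewrite -exprS.
Qed.

Lemma value_comb k t : value (comb k t) = x ^+ k * value t.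
Proof.
elim: k => [|k IH]; first by rewrite mul1r.
by rewrite exprS -mulrA -IH /value /= mulr1.
Qed.

Lemma value_word c : (0 < c)%N -> value (word c) = x ^+ c.
Proof. by case: c => // c _; rewrite value_comb -exprSr. Qed.

Lemma evs_words ws ts : all (fun c => 0 < c)%N ws ->
  evs MuN (map word ws ++ ts) (fun _ => x) = forms ws * evs MuN ts (fun _ => x).
Proof.
elim: ws => [|c ws IH] /=; first by rewrite /forms big_nil mul1r.
case/andP=> c0 ws0; rewrite IH // -/(value (word c)) value_word // /tw theta_xpow.
by rewrite forms_cons mulrA.
Qed.

Lemma evs_rcons ws t : all (fun c => 0 < c)%N ws ->
  evs MuN (rcons (map word ws) t) (fun _ => x) = forms ws * dd (value t).
Proof. by move=> ws0; rewrite -cats1 evs_words //= mulr1 tw0. Qed.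

Lemma value_nft m u cs : valid N m u cs ->
  value (nft N m u cs) = basis u cs.
Proof.
elim: m u cs => [|m IH] u cs V.
  case/and3P: V => /nilP -> _ u0.
  by rewrite /= value_word // /basis /forms big_nil mulr1.
have [V' E] := valid_last hN V.
rewrite value_comb; congr (_ * _).
rewrite /value ev_node evs_rcons ?IH // ?dd_basis; last first.
  by case/and3P: V => _ /allP cs0 _; apply/allP => c /mem_take/cs0.
by rewrite -forms_cat -cat_rcons -E.
Qed.

(** Powers of x move to the left, one form at a time, by d(x^c) x^u = d(x^(c+u)) - x^c d(x^u). *)
Lemma forms_xpow cs v : all (fun c => 0 < c)%N cs ->
  lspan (fun a => exists u ds, [/\ size ds = size cs, all (fun c => 0 < c)%N ds,
                               (u + sumn ds = sumn cs + v)%N & a = basis u ds])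
       (forms cs * x ^+ v).
Proof.
elim: cs => [|c cs IH] /=.
  move=> _; apply: span_gen; exists v, [::]; split=> //; first by rewrite addn0.
  by rewrite /basis /forms big_nil mul1r mulr1.
case/andP=> c0 /IH cs_span; rewrite forms_cons -mulrA.
apply: (@span_map _ _ (fun a => dd (x ^+ c) * a)) cs_span.
  by move=> d a b; rewrite mulrDr scale_mulr.
move=> _ [u [ds [sz ds0 sum ->]]]; rewrite /basis mulrA.
have -> : dd (x ^+ c) * x ^+ u = dd (x ^+ (c + u)) - x ^+ c * dd (x ^+ u).
  by rewrite exprD dd_mul theta_xpow addrK.
rewrite mulrBl -[_ * forms ds]mul1r -[_ * _ * forms ds]mulrA -!forms_cons.
rewrite addrC -scaleN1r; apply: span_lin; last first.
  apply: span_gen; exists 0%N, ((c + u)%N :: ds); split=> //=.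
  - by rewrite sz.
  - by rewrite addn_gt0 c0.
  - by lia.
(* For u = 0 this term contains d(1) = 0, so all exponents that remain are positive. *)
case: u sum => [|u] sum.
  by rewrite forms_cons expr0 dd1 mul0r mulr0; apply: Span0.
apply: span_gen; exists c, (u.+1 :: ds); split=> //=; first by rewrite sz.
by lia.
Qed.

Definition normal_below (s : ptree) (a : A) : Prop :=
  exists m u cs, [/\ valid N m u cs, (u + sumn cs)%N = leaves s,
                      tree_le (nft N m u cs) s & a = basis u cs].

Lemma validP m u cs : size cs = (m * N)%N -> all (fun c => 0 < c)%N cs ->
  (0 < u + sumn cs)%N -> valid N m u cs.
Proof.
move=> sz cs0 pos; apply/and3P; split=> //; first exact/eqP.
by case: m sz => //; case: cs cs0 pos => //= _; rewrite addn0.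
Qed.

(** With a leaf on the left, multiplication by x lengthens the comb of each normal monomial and
    respects the order. Otherwise every normal monomial with the right number of leaves is smaller,
    so it suffices to expand the product in basis elements. *)
Lemma mu2_below s t : wf N (Node Mu2 [:: s; t]) ->
  lspan (normal_below s) (value s) -> lspan (normal_below t) (value t) ->
  lspan (normal_below (Node Mu2 [:: s; t])) (value (Node Mu2 [:: s; t])).
Proof.
move=> wf_st Ps Pt.
have -> : value (Node Mu2 [:: s; t]) = value s * value t by rewrite /value /= mulr1.
case: s wf_st Ps => [|a ss] wf_st Ps.
  apply: (@span_map _ _ (fun b => x * b)) Pt => [c v w|]; first by rewrite mulrDr scale_mulr.
  move=> _ [m [u [cs [V sum le_t ->]]]].
  apply: span_gen; exists m, u.+1, cs; split.
  - by case/and3P: V => H1 H2 _; rewrite /valid H1 H2 addnS.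
  - by rewrite /= addSn sum add1n addn0.
  - have <- : Node Mu2 [:: Leaf; nft N m u cs] = nft N m u.+1 cs.
      by case: m V {le_t} => [|m] //; case: u {sum} => // /and3P[].
    apply: (@tree_le_last _ [:: Leaf]) le_t.
    by rewrite (leaves_nft hN V).
  - by rewrite /basis exprS mulrA.
have fin : forall b, (exists m u cs, [/\ size cs = (m * N)%N,
      all (fun c => 0 < c)%N cs,
      (u + sumn cs)%N = leaves (Node Mu2 [:: Node a ss; t]) & b = basis u cs]) ->
    normal_below (Node Mu2 [:: Node a ss; t]) b.
  move=> b [m [u [cs [sz cs0 sum ->]]]].
  have V : valid N m u cs by apply: validP => //; rewrite sum; apply: leaves_gt0 wf_st.
  exists m, u, cs; split=> //; apply/orP; right.
  by apply: tree_lt_nft_mu2 => //; rewrite (leaves_nft hN V).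
apply: span_sub fin _; apply: span_mul Ps Pt.
move=> _ _ [m [u [cs [V sum _ ->]]]] [m' [v [ds [V' sum' _ ->]]]].
rewrite /basis mulrA -[_ * forms cs * _]mulrA -mulrA.
case/and3P: V => /eqP sz cs0 _; case/and3P: V' => /eqP sz' ds0 _.
apply: (@span_map _ _ (fun b => x ^+ u * (b * forms ds))) (forms_xpow v cs0).
  by move=> c w w'; rewrite mulrDl mulrDr -scalerAl -scale_mulr.
move=> _ [u' [es [sze es0 sume ->]]]; apply: span_gen.
exists (m + m')%N, (u + u')%N, (es ++ ds); split.
- by rewrite size_cat sze sz sz' mulnDl.
- by rewrite all_cat es0.
- have -> : leaves (Node Mu2 [:: Node a ss; t]) = (leaves (Node a ss) + leaves t)%N.
    by rewrite /= addn0.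
  by rewrite sumn_cat -sum -sum'; lia.
- by rewrite /basis forms_cat exprD !mulrA.
Qed.

(** The twist only rescales; [dd] turns x^u into one more form and kills the terms with u = 0. *)
Lemma dd_tw_normal_below s k a : lspan (normal_below s) a ->
  lspan (fun b => exists m v ds, [/\ valid N m v ds, (0 < v)%N,
    (v + sumn ds)%N = leaves s, tree_le (nft N m v ds) s & b = forms (v :: ds)])
  (dd (tw k a)).
Proof.
apply: (@span_map _ _ (fun a => dd (tw k a))) => [c v w|]; first by rewrite !linearP.
move=> _ [m [u [cs [V sum le_s ->]]]]; rewrite tw_basis linearZ /= dd_basis.
apply: spanZ; case: u V sum le_s => [|u] V sum le_s.
  by rewrite forms_cons expr0 dd1 mul0r; apply: Span0.
by apply: span_gen; exists m, u.+1, cs.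
Qed.

(** No order is recorded, as this serves for the inputs to the right of the one that decides the
    comparison. *)
Lemma evs_muN_span ts :
  foldr (fun s Q => lspan (normal_below s) (value s) /\ Q) True ts ->
  lspan (fun a => exists k cs, [/\ size cs = (size ts + k * N)%N,
    all (fun c => 0 < c)%N cs, sumn cs = sumn (map leaves ts) & a = forms cs])
  (evs MuN ts (fun _ => x)).
Proof.
elim: ts => [_|s ts IH [/(dd_tw_normal_below (size ts)) Ps /IH Pts]].
  by apply: span_gen; exists 0%N, [::]; split=> //; rewrite /forms big_nil.
apply: span_mul Ps Pts.
move=> _ _ [m [v [ds [V v0 sum _ ->]]]] [k [cs [sz cs0 sum' ->]]].
apply: span_gen; exists (m + k)%N, (v :: ds ++ cs); case/and3P: V => /eqP szd ds0 _.
split; last by rewrite -forms_cat.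
- by rewrite /= size_cat szd sz; lia.
- by rewrite /= v0 all_cat ds0.
- by rewrite /= sumn_cat addnA sum sum'.
Qed.

(** Selects the input that decides the comparison under a root mu_N: the first one that is not a
    right comb, or else the last one. *)
Lemma words_prefix ts : all (wf N) ts -> ts <> [::] ->
  exists ws s rest, [/\ ts = map word ws ++ s :: rest, all (fun c => 0 < c)%N ws &
                         rest = [::] \/ s <> word (leaves s)].
Proof.
elim: ts => // s ts IH /= /andP[wf_s wf_ts] _.
have [sw|sw] := eqVneq s (word (leaves s)); last first.
  by exists [::], s, ts; split=> //; right; apply/eqP.
case: ts IH wf_ts => [|t ts] IH wf_ts.
  by exists [::], s, [::]; split=> //; left.
have [//|//|ws [s' [rest [-> ws0 Hs]]]] := IH.
exists (leaves s :: ws), s', rest; split=> //=; first by rewrite -sw.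
by rewrite (leaves_gt0 hN wf_s).
Qed.

(** The combs [ws] before the selected input [s] pass unchanged into the normal monomials. If [s] is
    the last input, it is replaced by a normal monomial that is not larger. Otherwise [word v] takes
    its place and is smaller on its own leaves. *)
Lemma muN_below ts : wf N (Node MuN ts) ->
  foldr (fun s Q => lspan (normal_below s) (value s) /\ Q) True ts ->
  lspan (normal_below (Node MuN ts)) (value (Node MuN ts)).
Proof.
move=> wf_ts Pts; case/andP: (wf_ts) => /eqP /= sz wf_all.
have [|ws [s [rest [tsE ws0 Hs]]]] := words_prefix wf_all.
  by move=> tsE; move: sz; rewrite tsE /=; lia.
have [wf_s Ps Prest] : [/\ wf N s, lspan (normal_below s) (value s) &
    foldr (fun s Q => lspan (normal_below s) (value s) /\ Q) True rest].
  move: Pts wf_all; rewrite tsE {tsE sz wf_ts}; elim: ws ws0 => [_ [Ps Pr] /andP[]//|w ws IH].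
  by case/andP=> _ ws0 [_ Pr] /andP[_ wf_r]; apply: IH.
have sumE : sumn (map leaves ts) = (sumn ws + (leaves s + sumn (map leaves rest)))%N.
  by rewrite tsE map_cat sumn_cat leaves_words.
rewrite /value ev_node tsE evs_words //= -/(value s).
have lin_ws : linear (fun a => forms ws * a).
  by move=> c v w; rewrite mulrDr scale_mulr.
apply: (span_map lin_ws); last first.
  apply: span_mul (dd_tw_normal_below (size rest) Ps) (evs_muN_span Prest).
  move=> _ _ [m [v [ds [V v0 sum le_s ->]]]] [k [cs [szc cs0 sumc ->]]].
  by apply: (span_gen (S := fun b => exists m v ds k cs, [/\ valid N m v ds, (0 < v)%N,
    (v + sumn ds)%N = leaves s, tree_le (nft N m v ds) s &
    [/\ size cs = (size rest + k * N)%N,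
    all (fun c => 0 < c)%N cs, sumn cs = sumn (map leaves rest) &
    b = forms (v :: ds) * forms cs]])); exists m, v, ds, k, cs.
move=> _ [m [v [ds [k [cs [V v0 sum le_s [szc cs0 sumc ->]]]]]]].
have szE : (size ws + (size rest).+1 = N)%N.
  by rewrite -sz tsE size_cat size_map.
case/and3P: (V) => /eqP szd ds0 _.
have V' : valid N (m + k).+1 0 (ws ++ v :: ds ++ cs).
  apply: validP; last by rewrite sumn_cat /=; lia.
    by rewrite size_cat /= size_cat szd szc; lia.
  by rewrite all_cat ws0 /= v0 all_cat ds0.
have sumV : (0 + sumn (ws ++ v :: ds ++ cs))%N = leaves (Node MuN (map word ws ++ s :: rest)).
  by rewrite -tsE /= sumE sumn_cat /= sumn_cat sumc -sum; lia.
apply: span_gen; exists (m + k).+1, 0%N, (ws ++ v :: ds ++ cs); split=> //; last first.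
  by rewrite /basis mul1r -!forms_cat.
have LV := leaves_nft hN V'; rewrite sumV in LV.
have [rest0|rest0] := eqVneq rest [::].
  move: LV; rewrite rest0 in szE szc sumc *.
  (* No inputs remain, so the positive exponents in [cs] add up to 0. *)
  have cs_nil : cs = [::] by case: cs cs0 sumc {szc V' sumV} => //= c cs /andP[]; lia.
  have k0 : k = 0%N by move: szc; rewrite cs_nil /=; lia.
  have szw : size ws = N.-1 by move: szE => /=; lia.
  rewrite cs_nil k0 cats0 addn0 nft_cat // cats1 => _.
  by apply: tree_le_last => //; rewrite (leaves_nft hN V).
have {Hs} Hs : s <> word (leaves s) by case: Hs rest0 => [->|//]; rewrite eqxx.
apply/orP; right; move: LV.
have sz_rest : (0 < size rest)%N by rewrite lt0n size_eq0.
(* Entry p of [r], counted from 0, is the N-th exponent, at which the last input of the root starts;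
   as [rest] is nonempty, v comes strictly before it. *)
pose p := (size rest).-1; pose r := ds ++ cs.
have szr : (p < size r)%N by rewrite size_cat szc /p; lia.
have -> : ws ++ v :: ds ++ cs =
    (ws ++ v :: take p r) ++ nth 0%N r p :: drop p.+1 r.
  by rewrite -catA cat_cons -(drop_nth 0%N szr) cat_take_drop.
have szp : size (ws ++ v :: take p r) = N.-1.
  by rewrite size_cat /= size_takel 1?ltnW // /p; lia.
rewrite nft_cat // map_cat rcons_cat /= => LV.
apply: tree_lt_muN_word => //; first by rewrite -sum leq_addr.
by apply: (nft_first_block hN V) => //; rewrite (leaves_nft hN V).
Qed.

Lemma value_span s : wf N s -> lspan (normal_below s) (value s).
Proof.
elim/ptree_ind': s => [|a ts IH] wf_s.
  apply: span_gen; exists 0%N, 1%N, [::]; split=> //.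
  by rewrite /basis /forms big_nil mulr1.
have {IH} Pts : foldr (fun s Q => lspan (normal_below s) (value s) /\ Q) True ts.
  case/andP: wf_s => _; elim: ts IH => //= t ts IHts [IHt IHl] /andP[wf_t wf_ts].
  by split; [apply: IHt | apply: IHts].
case: a wf_s => wf_s; last exact: muN_below.
case: ts wf_s Pts => [|s [|t [|]]] //= wf_s [Ps [Pt _]].
exact: mu2_below.
Qed.

(** * Leading terms of the ideal are never normal *)

Context (coef : nat -> seq nat -> A -> K).
Context (coef_lin : forall u cs, linear (coef u cs : A -> K^o)).
Context (coef_basis : forall u cs v ds,
  all (fun c => 0 < c)%N cs -> all (fun c => 0 < c)%N ds ->
  (coef u cs (basis v ds) != 0) = ((u, cs) == (v, ds))).

Lemma coef_span u cs (S : A -> Prop) a :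
  (forall b, S b -> coef u cs b = 0) -> lspan S a -> coef u cs a = 0.
Proof.
move=> S0; elim=> [|c b e Sb _ IH].
  by have := GRing.scalable_linear (coef_lin u cs) 0 0; rewrite /= !scale0r.
by rewrite (coef_lin u cs) IH S0 // scaler0 addr0.
Qed.

(** If t were normal, the functional [coef u cs] that detects its value would see no other monomial
    of f: these are smaller than t, and their values involve only normal monomials that are not
    larger than they are. As f evaluates to 0, the coefficient of t would vanish. *)
Lemma leading_not_normal n f t m u cs :
  ideal_generated N (@defining_relation K N) n f -> component N n f ->
  leading_term f t -> valid N m u cs -> t <> nft N m u cs.
Proof.
move=> If cf [t_f t_lead] V tE.
have tw_x s : evt s (fun _ => x) = value s.
  by apply: ev_ext => j _; rewrite /tw theta_x.
have cs0 : all (fun c => 0 < c)%N cs by case/and3P: V.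
have ft : f@_t != 0 by rewrite mcoeff_neq0.
have coef0 s : s \in msupp f -> s != t -> coef u cs (value s) = 0.
  move=> s_f st; have [wf_s Ls] := cf s s_f; have [wf_t Lt] := cf t t_f.
  have lt_st : tree_lt s t by case: (t_lead s s_f) => // /eqP; rewrite (negPf st).
  apply: (coef_span _ (value_span wf_s)) => _ [m' [v [ds [V' _ le_s ->]]]].
  apply/eqP; apply: contraTT isT; rewrite coef_basis //; last by case/and3P: V'.
  move=> /eqP[uv csd]; move: le_s; rewrite -uv -csd.
  (* The number of exponents, m N, determines m. *)
  have -> : m' = m.
    case/and3P: V => /eqP sz _ _; case/and3P: V' => /eqP; rewrite -csd sz => /eqP.
    by rewrite eqn_pmul2r ?(leq_trans _ hN) // => /eqP ->.
  rewrite -tE => /orP[/eqP ts|/(tree_lt_trans lt_st)]; last by rewrite tree_lt_irr.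
  by rewrite ts eqxx in st.
have := ideal_killed If (tdeg N t) (fun _ => x).
move/(congr1 (coef u cs)); rewrite /eval_deg /lext (big_fsetD1 t) //= eqxx tw_x.
rewrite (coef_lin u cs).
have c0 : coef u cs 0 = 0.
  by have := GRing.scalable_linear (coef_lin u cs) 0 0; rewrite /= !scale0r.
rewrite big_seq; set rest := (X in _ + coef u cs X).
have -> : coef u cs rest = 0.
  rewrite /rest; elim/big_rec: _ => [//|s a Hs IH]; rewrite (coef_lin u cs) IH addr0.
  move: Hs; rewrite in_fsetD1 => /andP[st s_f].
  by case: ifP => _; rewrite ?tw_x ?coef0 ?c0 // scaler0.
rewrite c0 addr0 => /eqP; rewrite mulf_eq0 (negPf ft) /=; apply/negP.
by rewrite tE value_nft // coef_basis // eqxx.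
Qed.

End SuperDerivation.

(** * A faithful model *)

(* The pair (w, k) stands for the product w D^k in the algebra generated by the
   letters a = true, b = false and an element D with central square, such that
   D a = b D and D b = a D. *)
Definition cword := (seq bool * nat)%type.
HB.instance Definition _ := Choice.copy cword (seq bool * nat)%type.

Definition flip (k : nat) (w : seq bool) : seq bool := map (addb (odd k)) w.

Definition cword_one : cword := ([::], 0).
Definition cword_mul (u v : cword) : cword :=
  (u.1 ++ flip u.2 v.1, (u.2 + v.2)%N).

Lemma flip0 : flip 0 =1 id.
Proof. by move=> w; apply: map_id. Qed.

Lemma flipD k l w : flip (k + l) w = flip k (flip l w).
Proof. by rewrite /flip -map_comp; apply: eq_map => b; rewrite /= oddD addbA. Qed.

Lemma flip_inj k : injective (flip k).
Proof. exact/inj_map/addbI. Qed.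

Lemma cword_mulA : associative cword_mul.
Proof.
by move=> u v w; rewrite /cword_mul /= addnA flipD /flip map_cat catA.
Qed.

Lemma cword_mul1m : left_id cword_one cword_mul.
Proof. by case=> w k; rewrite /cword_mul /= flip0. Qed.

Lemma cword_mulm1 : right_id cword_one cword_mul.
Proof. by case=> w k; rewrite /cword_mul /= cats0 addn0. Qed.

Lemma cword_unitm u v : cword_mul u v = cword_one ->
  u = cword_one /\ v = cword_one.
Proof. by case: u v => [[|? ?] [|?]] [[|? ?] [|?]]. Qed.

HB.instance Definition _ := Choice_isMonomialDef.Build cword
  cword_mulA cword_mul1m cword_mulm1 cword_unitm.

Lemma cword_mulI u : injective (cword_mul u).
Proof.
move=> [v k] [w l] [] /eqP; rewrite eqseq_cat // eqxx /= => /eqP/flip_inj ->.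
by move=> /addnI ->.
Qed.

(* The word b^c_1 a^c_2 b^c_3 .., as flip 1 exchanges the two letters. *)
Fixpoint alt (cs : seq nat) : seq bool :=
  if cs is c :: cs' then nseq c false ++ flip 1 (alt cs') else [::].

(** The words in the expansion of d(a^d_1) d(a^d_2) .., where d(a^n) = b^n D - a^n D: [bs] records
    the letter chosen in each factor, before the D's on its left exchange letters. *)
Fixpoint runs (bs : seq bool) (ds : seq nat) : seq bool :=
  match bs, ds with
  | b :: bs', d :: ds' => nseq d b ++ flip 1 (runs bs' ds')
  | _, _ => [::]
  end.

Lemma flip1K : involutive (flip 1).
Proof. by move=> w; rewrite -flipD; apply: map_id. Qed.

Lemma flip_cat k w w' : flip k (w ++ w') = flip k w ++ flip k w'.
Proof. exact: map_cat. Qed.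

Lemma flip_nseq b n : flip 1 (nseq n b) = nseq n (~~ b).
Proof. by rewrite /flip map_nseq. Qed.

Lemma alt_head e cs w : all (fun c => 0 < c)%N cs ->
  alt cs = nseq e true ++ w -> e = 0%N.
Proof. by case: e cs => // e [|[|c] cs]. Qed.

Lemma cat_nseqI (b : bool) n w w' : nseq n b ++ w = nseq n b ++ w' -> w = w'.
Proof. by elim: n => //= n IH [/IH]. Qed.

Lemma nseq_split (b : bool) n m : (n <= m)%N ->
  nseq m b = nseq n b ++ nseq (m - n) b.
Proof. by move=> nm; rewrite -nseqD subnKC. Qed.

(** The left word has [size cs] maximal runs of equal letters, and one more if e > 0; the right word
    consists of [size ds] constant blocks, hence has at most that many runs. So e = 0, and the
    blocks are the runs. *)
Lemma alt_runs e cs bs ds : all (fun c => 0 < c)%N cs -> all (fun c => 0 < c)%N ds ->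
  size bs = size ds -> (size ds <= size cs)%N ->
  nseq e true ++ alt cs = runs bs ds -> e = 0%N /\ cs = ds.
Proof.
elim: ds bs e cs => [|d ds IH] [|b bs] e [|c cs] //=.
- by case: e.
- by case: e => //; case: c.
case/andP=> c0 cs0 /andP[d0 ds0] [sz_b] sz.
case: e => [|e] /= E.
  have b_false : b = false by case: c d c0 d0 E => [|c] [|d] //= _ _ [].
  rewrite b_false in E; case: (leqP d c) => dc.
    move: E; rewrite (nseq_split _ dc) -catA => /cat_nseqI/(congr1 (flip 1)).
    rewrite flip_cat flip_nseq !flip1K /= => /(IH _ _ _ cs0 ds0 sz_b sz)[cd ->].
    by split=> //; congr (_ :: _); lia.
  move: E; rewrite (nseq_split _ (ltnW dc)) -catA => /cat_nseqI/(congr1 (flip 1)).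
  by rewrite flip_cat flip_nseq !flip1K /= => /(alt_head cs0); lia.
have b_true : b = true by case: d d0 E => //= d _ [].
rewrite b_true -[true :: _]/(nseq e.+1 true ++ _) in E.
case: (leqP d e.+1) => de.
  move: E; rewrite (nseq_split _ de) -catA => /cat_nseqI/(congr1 (flip 1)).
  rewrite !flip_cat !flip_nseq !flip1K /=; case: (posnP (e.+1 - d)) => [->|e0] E.
    by have [c_0 _] := IH _ c cs cs0 ds0 sz_b sz E; rewrite c_0 in c0.
  (* After the exchange of letters, the remaining word is [alt] of a list longer than [ds]. *)
  have [] := IH bs 0%N ((e.+1 - d)%N :: c :: cs) _ ds0 sz_b.
  - by rewrite /= e0 c0.
  - by rewrite /=; lia.
  - by rewrite /= flip_cat flip_nseq flip1K.
  by move=> _ dsE; move: sz; rewrite -dsE /=; lia.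
move: E; rewrite (nseq_split _ (ltnW de)) -catA => /cat_nseqI.
case: c c0 => // c _; case: (d - e.+1)%N (subn_gt0 e.+1 d) => [|k]; last by [].
by rewrite de.
Qed.

(** * The model as a graded algebra with coefficient functionals *)

Section Model.

Context (K : fieldType).

Notation A := {malg K[cword]}.

Lemma mulUU c1 c2 (k1 k2 : cword) :
  << c1 *g k1 >> * << c2 *g k2 >> = << c1 * c2 *g cword_mul k1 k2 >> :> A.
Proof. exact: fgmulUU. Qed.

Lemma malg_scaleAr c (a b : A) : c *: (a * b) = a * (c *: b).
Proof.
move: a; elim/malg_ind => [c1 k1 f IHf|]; last by rewrite !mul0r scaler0.
rewrite !mulrDl scalerDr IHf; congr (_ + _).
clear IHf; elim/malg_ind: b => [c2 k2 g IHg|]; last by rewrite scaler0 !mulr0 scaler0.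
rewrite scalerDr !mulrDr scalerDr IHg; congr (_ + _).
by rewrite scaleU !mulUU scaleU mulrCA.
Qed.

(** The degree of w D^k is k, so the letters are even and D is odd. *)
Definition theta (c : K) : A -> A := lext (fun k : cword => << c ^+ k.2 *g k >>).

Lemma theta_is_linear c : linear (theta c).
Proof. exact: linearP. Qed.
HB.instance Definition _ c :=
  GRing.isLinear.Build K A A _ (theta c) (theta_is_linear c).

Lemma thetaU c z (k : cword) : theta c << z *g k >> = << z * c ^+ k.2 *g k >>.
Proof. by rewrite /theta lextU scaleU. Qed.

Lemma theta1 : theta 1 =1 id.
Proof.
elim/malg_ind => [z k f IH|]; last by rewrite linear0.
by rewrite linearD /= IH thetaU expr1n mulr1.
Qed.

Lemma thetaM c c' a : theta c (theta c' a) = theta (c * c') a.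
Proof.
elim/malg_ind: a => [z k f IH|]; last by rewrite !linear0.
by rewrite !linearD /= IH !thetaU exprMn -mulrA [c' ^+ _ * _]mulrC.
Qed.

Lemma theta_mul c a b : theta c (a * b) = theta c a * theta c b.
Proof.
move: a; elim/malg_ind => [c1 k1 f IHf|]; last by rewrite linear0 !mul0r linear0.
rewrite !mulrDl !linearD /= mulrDl IHf; congr (_ + _).
clear IHf; elim/malg_ind: b => [c2 k2 g IHg|]; last by rewrite linear0 !mulr0 linear0.
rewrite !mulrDr !linearD /= mulrDr IHg; congr (_ + _).
by rewrite mulUU !thetaU mulUU exprD; congr << _ *g _ >>; ring.
Qed.

Lemma theta_one c : theta c 1 = 1.
Proof. by rewrite thetaU expr0 mulr1. Qed.

Definition vD : A := << (([::], 1) : cword) >>.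
Definition vx : A := << (([:: true], 0) : cword) >>.

Lemma theta_vD c : theta c vD = c *: vD.
Proof. by rewrite thetaU scaleU expr1 mul1r mulr1. Qed.

Lemma theta_vx c : theta c vx = vx.
Proof. by rewrite thetaU expr0 mulr1. Qed.

Lemma central_basis (q : A) :
  (forall z (k : cword), q * << z *g k >> = << z *g k >> * q) ->
  forall a, q * a = a * q.
Proof.
move=> qU; elim/malg_ind => [z k f IH|]; last by rewrite mulr0 mul0r.
by rewrite mulrDr mulrDl IH qU.
Qed.

Lemma vDD_central (a : A) : vD * vD * a = a * (vD * vD).
Proof.
apply: central_basis => z k; rewrite !mulUU; congr << _ *g _ >>; last by rewrite mulrC.
case: k => w k; rewrite /cword_mul /= cats0 addnC; congr pair.
by apply: map_id.
Qed.

Lemma mcoeff_mulU (g k : cword) (q : A) : (<< g >> * q)@_(cword_mul g k) = q@_k.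
Proof.
elim/malg_ind: q => [z l f IH|]; last by rewrite mulr0 !mcoeff0.
rewrite mulrDr !mcoeffD IH mulUU mul1r !mcoeffU.
by rewrite (inj_eq (@cword_mulI g)).
Qed.

Lemma mcoeff_mulU0 (g l : cword) (q : A) :
  (forall k, cword_mul g k <> l) -> (<< g >> * q)@_l = 0.
Proof.
move=> gl; elim/malg_ind: q => [z k f IH|]; last by rewrite mulr0 mcoeff0.
rewrite mulrDr mcoeffD IH mulUU mcoeffU addr0; case: eqP => //; case/gl.
Qed.

Local Notation ddx := (dd vD theta).
Local Notation formsx := (forms vD theta vx).
Local Notation basisx := (basis vD theta vx).

Lemma vx_exp n : vx ^+ n = << ((nseq n true, 0) : cword) >>.
Proof.
by elim: n => // n IH; rewrite exprS IH mulUU mulr1 /cword_mul /= flip0.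
Qed.

Lemma dd_vx n : ddx (vx ^+ n) =
  << ((nseq n false, 1) : cword) >> - << ((nseq n true, 1) : cword) >>.
Proof.
rewrite /dd /= vx_exp thetaU expr0 mulr1 !mulUU !mulr1 /cword_mul /= cats0.
by rewrite flip_nseq.
Qed.

(** Each factor contributes one D and one block of equal letters. *)
Lemma mcoeff_forms ds (w : seq bool) k : (formsx ds)@_((w, k) : cword) != 0 ->
  k = size ds /\ exists2 bs, size bs = size ds & w = runs bs ds.
Proof.
elim: ds w k => [|d ds IH] w k.
  rewrite /forms big_nil mcoeffU.
  case: (@eqP _ _ ((w, k) : cword)) => [E _|_]; last by rewrite mulr0n eqxx.
  by case: E => <- <-; split=> //; exists [::].
rewrite forms_cons dd_vx mulrBl mcoeffB.
have step b : (<< ((nseq d b, 1) : cword) >> * formsx ds)@_((w, k) : cword) != 0 ->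
    k = (size ds).+1 /\ exists2 bs, size bs = (size ds).+1 & w = runs bs (d :: ds).
  rewrite mcoeff_neq0 => /msuppM_le [k1 [[w2 k2] []]].
  rewrite msuppU1 in_fset1 => /eqP -> q_k2 [-> ->].
  have [-> [bs sz ->]] : k2 = size ds /\ exists2 bs, size bs = size ds & w2 = runs bs ds.
    by apply: IH; rewrite mcoeff_neq0.
  by split=> //; exists (b :: bs) => //=; rewrite sz.
move=> nz; have [z0|/step//] :=
  eqVneq (<< ((nseq d false, 1) : cword) >> * formsx ds)@_((w, k) : cword) 0.
by apply: (step true); move: nz; rewrite z0 sub0r oppr_eq0.
Qed.

Definition coef (u : nat) (cs : seq nat) (a : A) : K :=
  a@_((nseq u true ++ alt cs, size cs) : cword).

Lemma coef_lin u cs : linear (coef u cs : A -> K^o).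
Proof. by move=> c a b; rewrite /coef mcoeffD mcoeffZ. Qed.

(** Choosing a^c in the first factor would change the first letter, so b^c is chosen at every
    stage. *)
Lemma coef_forms cs : all (fun c => 0 < c)%N cs -> coef 0 cs (formsx cs) = 1.
Proof.
elim: cs => [|c cs IH] /=; first by rewrite /coef /forms big_nil mcoeffU eqxx.
case/andP=> c0 cs0; rewrite forms_cons dd_vx mulrBl /coef mcoeffB /=.
rewrite -[(_, _)]/(cword_mul (nseq c false, 1%N) (alt cs, size cs)).
rewrite mcoeff_mulU [(formsx cs)@__](IH cs0) mcoeff_mulU0 ?subr0 //.
by case=> w k; case: c c0.
Qed.

(** The exponent of D gives size ds = size cs. If v <= u, cancelling a^v leaves a leading a^(u-v),
    and [alt_runs] gives u = v and cs = ds; if v > u, [alt cs] would start with a. *)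
Lemma coef_basis u cs v ds :
  all (fun c => 0 < c)%N cs -> all (fun c => 0 < c)%N ds ->
  (coef u cs (basisx v ds) != 0) = ((u, cs) == (v, ds)).
Proof.
move=> cs0 ds0; apply/idP/eqP => [|[<- <-]]; last first.
  rewrite /basis /coef vx_exp.
  have -> : ((nseq u true ++ alt cs, size cs) : cword) =
      cword_mul (nseq u true, 0%N) (alt cs, size cs).
    by rewrite /cword_mul /= flip0.
  by rewrite mcoeff_mulU [X in X != 0](coef_forms cs0) oner_eq0.
rewrite /coef mcoeff_neq0 => /msuppM_le [k1 [[w k] []]].
rewrite vx_exp msuppU1 in_fset1 => /eqP -> {k1}.
rewrite -mcoeff_neq0 => /mcoeff_forms [-> [bs sz ->]] [].
rewrite flip0 add0n => wE szE; case: (leqP v u) => uv.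
  move: wE; rewrite (nseq_split _ uv) -catA => /cat_nseqI.
  case/(alt_runs cs0 ds0 sz); first by rewrite szE.
  by move=> uv0 ->; congr pair; lia.
move: wE; rewrite (nseq_split _ (ltnW uv)) -catA => /cat_nseqI/(alt_head cs0).
by lia.
Qed.

Lemma leading_not_nft (N : nat) (hN : (3 <= N)%N) n f t m u cs :
  ideal_generated N (@defining_relation K N) n f -> component N n f ->
  leading_term f t -> valid N m u cs -> t <> nft N m u cs.
Proof.
apply: (@leading_not_normal K A vD (fun c => theta c) malg_scaleAr theta_mul
  theta_one theta1 thetaM theta_vD vDD_central N hN vx theta_vx coef coef_lin coef_basis).
Qed.

End Model.

(** * The adjoined relations *)

Section AdjoinedRelations.

Context (K : fieldType) (N : nat) (hN : (3 <= N)%N).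

Local Notation elt := {malg K[ptree]}.
Implicit Types f g : elt.

Local Notation sg x := ((-1 : K) ^ x).
Local Notation "f \o_( i ) g" := (opcomp N f i g)
  (at level 40, i at level 99, left associativity).
Local Notation mu2 := (mu2 K N).
Local Notation muN := (muN K N).
Local Notation mu2pow := (mu2pow K N).

Lemma msupp_witness f : f != 0 -> exists t, t \in msupp f.
Proof.
move=> f0; apply/fset0Pn; apply: contra_neq f0 => supp0.
by rewrite [f]monalgE supp0 big_seq_fset0.
Qed.

Lemma opcomp_linl i g : linear (fun f : elt => f \o_(i) g).
Proof. by move=> c f f'; rewrite !opcompE linearP. Qed.

Lemma opcomp_linr i f : linear (fun g : elt => f \o_(i) g).
Proof. by move=> c g g'; rewrite !opcompE ![lext _ f]lext_exchange linearP. Qed.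

Lemma opcompZl i g c f : (c *: f) \o_(i) g = c *: (f \o_(i) g).
Proof. exact: (GRing.scalable_linear (opcomp_linl i g)). Qed.

Lemma opcompZr i f c g : f \o_(i) (c *: g) = c *: (f \o_(i) g).
Proof. exact: (GRing.scalable_linear (opcomp_linr i f)). Qed.

Lemma opcompDl i g f f' : (f + f') \o_(i) g = f \o_(i) g + f' \o_(i) g.
Proof. by have := opcomp_linl i g 1 f f'; rewrite !scale1r. Qed.

Lemma opcompDr i f g g' : f \o_(i) (g + g') = f \o_(i) g + f \o_(i) g'.
Proof. by have := opcomp_linr i f 1 g g'; rewrite !scale1r. Qed.

Lemma opcompBl i g f f' : (f - f') \o_(i) g = f \o_(i) g - f' \o_(i) g.
Proof. by rewrite opcompDl -scaleN1r opcompZl scaleN1r. Qed.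

Lemma opcompBr i f g g' : f \o_(i) (g - g') = f \o_(i) g - f \o_(i) g'.
Proof. by rewrite opcompDr -scaleN1r opcompZr scaleN1r. Qed.

Lemma opcomp_suml i g r (P : pred nat) F :
  (\sum_(j <- r | P j) F j) \o_(i) g = \sum_(j <- r | P j) (F j \o_(i) g).
Proof.
apply: (big_morph (fun f => f \o_(i) g)) => [f f'|]; first exact: opcompDl.
by rewrite -(scale0r (0 : elt)) opcompZl !scale0r.
Qed.

Lemma opcomp_sumr i f r (P : pred nat) F :
  f \o_(i) (\sum_(j <- r | P j) F j) = \sum_(j <- r | P j) (f \o_(i) F j).
Proof.
apply: (big_morph (fun g => f \o_(i) g)) => [g g'|]; first exact: opcompDr.
by rewrite -(scale0r (0 : elt)) opcompZr !scale0r.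
Qed.

Lemma tdeg_comb k t : tdeg N (comb k t) = tdeg N t.
Proof. by elim: k => //= k ->; rewrite !add0r addr0. Qed.

Lemma mu2powE k : mu2pow k = << comb k Leaf >>.
Proof. by elim: k => //= k ->; rewrite opcomp1 tdeg_comb mul0r expr0z. Qed.

Lemma component_mu2 : component N 2 mu2.
Proof. exact: (componentU (wf_corolla N Mu2) (leaves_corolla N Mu2)). Qed.

Lemma component_muN : component N N muN.
Proof. exact: (componentU (wf_corolla N MuN) (leaves_corolla N MuN)). Qed.

Lemma component_mu2pow k : component N k.+1 (mu2pow k).
Proof. by rewrite mu2powE; apply: componentU; rewrite ?wf_comb // leaves_comb addn1. Qed.

Lemma component_star n m k q (f g : elt) : (0 < n)%N ->
  component N n f -> component N m g -> component N (n + m - 1) (star N n f k q g).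
Proof.
move=> n0 cf cg; rewrite /star big_nat; elim/big_ind: _ => [|u v cu cv|i Hi].
- exact: component0.
- by rewrite -[u]scale1r; apply: component_linear.
rewrite -[_ *: _]addr0; apply: component_linear (@component0 _ _ _).
exact: component_opcomp.
Qed.

Lemma component_is_ideal : is_ideal N (fun n f => component N n f).
Proof.
split=> //.
- exact: component0.
- by move=> n c f g; apply: component_linear.
- by move=> n d f; apply: component_deg_part.
- by move=> n m i f g; apply: component_opcomp.
by move=> n m i f g; apply: component_opcomp.
Qed.

Lemma component_defining f : defining_relation N f -> exists n, component N n f.
Proof.
case=> [||i Hi].
- by exists (2 + 2 - 1)%N; apply: component_star component_mu2 component_mu2.
- exists (2 + N - 1)%N; rewrite -[star N 2 _ _ _ _]scale1r; apply: component_linear.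
    exact: component_star component_mu2 component_muN.
  rewrite addnC; apply: component_star component_muN component_mu2.
  by lia.
by exists (N + N - 1)%N; apply: component_opcomp component_muN component_muN.
Qed.

(** * Consequences of the defining relations in an arbitrary ideal *)

Section Ideal.

Context (I : nat -> elt -> Prop) (idI : is_ideal N I).
Context (relI : forall m g, defining_relation N g -> component N m g -> I m g).

Lemma ideal_scale n c f : I n f -> I n (c *: f).
Proof. by move=> If; rewrite -[_ *: f]addr0; apply: (ideal_linear idI) If (ideal0 idI n). Qed.

Lemma ideal_add n f g : I n f -> I n g -> I n (f + g).
Proof. by move=> If Ig; rewrite -[f]scale1r; apply: (ideal_linear idI). Qed.

Lemma ideal_sub n f g : I n f -> I n g -> I n (f - g).
Proof. by move=> If Ig; rewrite -scaleN1r addrC; apply: (ideal_linear idI). Qed.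

Lemma ideal_sum n r (P : pred nat) F : (forall i, P i -> I n (F i)) ->
  I n (\sum_(i <- r | P i) F i).
Proof.
move=> IF; elim/big_ind: _ => //; [exact: ideal0 idI n | exact: ideal_add].
Qed.

Lemma ideal_canr n f g : I n g -> I n (f + g) -> I n f.
Proof. by move=> Ig /ideal_sub/(_ Ig); rewrite addrK. Qed.

Lemma compl n n' m i f g : I n f -> component N m g -> (1 <= i <= n)%N ->
  n' = (n + m - 1)%N -> I n' (f \o_(i) g).
Proof. by move=> If cg Hi ->; apply: (ideal_compl idI). Qed.

Lemma compr n n' m i f g : component N n f -> I m g -> (1 <= i <= n)%N ->
  n' = (n + m - 1)%N -> I n' (f \o_(i) g).
Proof. by move=> cf Ig Hi ->; apply: (ideal_compr idI). Qed.

Lemma ideal_mu2_mu2 : I 3 (mu2 \o_(1) mu2 - mu2 \o_(2) mu2).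
Proof.
have := relI (Rel22 K N) (@component_star 2 2 2 0 _ _ isT component_mu2 component_mu2).
rewrite /star big_ltn // big_nat1 !mul0r !add0r subrr mulr0 expr0z scale1r.
by rewrite [(-1) ^ _](_ : _ = -1) // scaleN1r.
Qed.

Definition relation2N : elt := (-1) ^+ N *: (mu2 \o_(1) muN) - mu2 \o_(2) muN
  + \sum_(1 <= j < N.+1) (-1) ^+ j.-1 *: (muN \o_(j) mu2).

Lemma relation2NE : star N 2 mu2 N (2 - N%:Z) muN + star N N muN 2 0 mu2 = relation2N.
Proof.
rewrite /relation2N; congr (_ + _); rewrite /star.
  rewrite big_ltn // big_nat1.
  have -> : (2 - N%:Z) * (2%:Z - 1) + (N%:Z - 1) * (1%:Z - 1) = 1 * (2 - N%:Z) by ring.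
  have -> : (2 - N%:Z) * (2%:Z - 1) + (N%:Z - 1) * (2%:Z - 1) = 1 by ring.
  by rewrite sg_arity expr1z scaleN1r.
rewrite big_nat [RHS]big_nat; apply: eq_bigr => j Hj; congr (_ *: _).
by rewrite mul0r add0r mul1r exprnP; congr (_ ^ _); lia.
Qed.

Lemma ideal_relation2N : I N.+1 relation2N.
Proof.
rewrite -relation2NE; apply: relI; first exact: Rel2N.
rewrite -[star N 2 _ _ _ _]scale1r; apply: component_linear.
  have -> : N.+1 = (2 + N - 1)%N by lia.
  exact: component_star component_mu2 component_muN.
have -> : N.+1 = (N + 2 - 1)%N by lia.
by apply: component_star component_muN component_mu2; lia.
Qed.

Lemma ideal_muN_muN i : (1 <= i <= N)%N -> I (N + N - 1) (muN \o_(i) muN).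
Proof.
move=> Hi; apply: relI; first exact: RelNN.
exact: component_opcomp component_muN component_muN.
Qed.

Definition inner (i : nat) : elt := muN \o_(i) (mu2 \o_(2) muN).
Definition inner' (i : nat) : elt := muN \o_(i) (mu2 \o_(1) muN).

(** Leaf i + 1 of mu_N o_j mu_2 hangs on mu_N itself, so the two graftings commute up to sign and
    some mu_N o mu_N appears. *)
Lemma ideal_far i j : (1 <= i < N)%N -> (1 <= j <= N)%N -> j != i -> j != i.+1 ->
  I (N + N) ((muN \o_(j) mu2) \o_(i.+1) muN).
Proof.
move=> Hi Hj ji ji1; have [lt_ji|le_ij] := ltnP j i.
  rewrite (@opcomp_right K N (corolla N MuN) (corolla N Mu2)); last 2 first.
  - by lia.
  - by rewrite !leaves_corolla /=; lia.
  have -> : (i.+1 - leaves (corolla N Mu2) + 1 = i)%N.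
    by rewrite leaves_corolla /=; lia.
  have Hi' : (1 <= i <= N)%N by lia.
  by apply: ideal_scale; apply: (compl (ideal_muN_muN Hi') component_mu2); lia.
rewrite (@opcomp_left K N (corolla N MuN) (corolla N Mu2)); last 2 first.
- by lia.
- by rewrite leaves_corolla /=; lia.
have Hi' : (1 <= i.+1 <= N)%N by lia.
apply: ideal_scale; apply: (compl (ideal_muN_muN Hi') component_mu2); last by lia.
by rewrite leaves_corolla /=; lia.
Qed.

(** When mu_N is grafted on leaf i + 1 of [relation2N], it lands on mu_2 only in the summands j = i
    and j = i + 1; all other terms contain mu_N o mu_N. *)
Lemma relation2N_muN i : (1 <= i < N)%N ->
  I (N + N) (inner i - inner' i.+1).
Proof.
move=> Hi.
have H : I (N + N) (relation2N \o_(i.+1) muN).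
  by apply: (compl ideal_relation2N component_muN); lia.
have E0 : (mu2 \o_(1) muN) \o_(i.+1) muN = mu2 \o_(1) (muN \o_(i.+1) muN).
  rewrite (@opcomp_nested K N (corolla N Mu2) (corolla N MuN)) ?leaves_corolla //=; try lia.
  by congr (_ \o_(_) (_ \o_(_) _)); lia.
have E1 : (mu2 \o_(2) muN) \o_(i.+1) muN = mu2 \o_(2) (muN \o_(i) muN).
  rewrite (@opcomp_nested K N (corolla N Mu2) (corolla N MuN)) ?leaves_corolla //=; try lia.
  by congr (_ \o_(_) (_ \o_(_) _)); lia.
have E2 : (muN \o_(i) mu2) \o_(i.+1) muN = inner i.
  rewrite (@opcomp_nested K N (corolla N MuN) (corolla N Mu2)) ?leaves_corolla //=; try lia.
  by congr (_ \o_(_) (_ \o_(_) _)); lia.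
have E3 : (muN \o_(i.+1) mu2) \o_(i.+1) muN = inner' i.+1.
  rewrite (@opcomp_nested K N (corolla N MuN) (corolla N Mu2)) ?leaves_corolla //=; try lia.
  by congr (_ \o_(_) (_ \o_(_) _)); lia.
pose F j := ((-1) ^+ j.-1 *: (muN \o_(j) mu2)) \o_(i.+1) muN.
have FE : \sum_(1 <= j < N.+1) F j = \sum_(1 <= j < i) F j +
    (F i + (F i.+1 + \sum_(i.+2 <= j < N.+1) F j)).
  rewrite (big_cat_nat (n := i)) /=; try lia.
  by congr (_ + _); rewrite big_ltn; [congr (_ + _); rewrite big_ltn //; lia | lia].
have far a b : (forall j, (a <= j < b)%N -> [&& 1 <= j <= N, j != i & j != i.+1]%N) ->
    I (N + N) (\sum_(a <= j < b) F j).
  move=> Pj; rewrite big_nat; apply: ideal_sum => j /Pj/and3P[Hj ji ji1].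
  by rewrite /F opcompZl; apply/ideal_scale/ideal_far.
have signE : F i + F i.+1 = (-1) ^+ i.-1 *: (inner i - inner' i.+1).
  rewrite /F !opcompZl E2 E3 scalerBr; congr (_ + _).
  by case: i Hi {E0 E1 E2 E3 FE far F H} => // i _; rewrite exprS mulN1r scaleNr.
move: H; rewrite /relation2N opcompDl opcompBl opcompZl opcomp_suml FE E0 E1.
have regroup (a b s1 f1 f2 s2 : elt) :
    a - b + (s1 + (f1 + (f2 + s2))) = f1 + f2 + (a - b + s1 + s2).
  by rewrite [RHS]addrC !addrA [LHS]addrAC [a - b + s1 + f1 + s2]addrAC.
rewrite regroup signE => H; have {}H : I (N + N) ((-1) ^+ i.-1 *: (inner i - inner' i.+1)).
  apply: ideal_canr H.
  apply: ideal_add; last by apply: far => j Hj; apply/and3P; split; lia.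
  apply: ideal_add; last by apply: far => j Hj; apply/and3P; split; lia.
  have Hi1 : (1 <= i <= N)%N by lia.
  have Hi2 : (1 <= i.+1 <= N)%N by lia.
  apply: ideal_sub; first apply: ideal_scale.
    by apply: (compr component_mu2 (ideal_muN_muN Hi2)); lia.
  by apply: (compr component_mu2 (ideal_muN_muN Hi1)); lia.
have := ideal_scale ((-1) ^+ i.-1) H.
by rewrite scalerA -expr2 sqrr_sign scale1r.
Qed.

(** With the relation grafted into mu_N, all terms mu_N o_j mu_2 create mu_N o mu_N, and only the
    two composites of mu_2 with mu_N survive. *)
Lemma muN_relation2N i : (1 <= i < N)%N ->
  I (N + N) (inner i.+1 - (-1) ^+ N *: inner' i.+1).
Proof.
move=> Hi.
have H : I (N + N) (muN \o_(i.+1) relation2N).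
  by apply: (compr component_muN ideal_relation2N); lia.
have Hi' : (1 <= i.+1 <= N)%N by lia.
have Isum : I (N + N)
    (\sum_(1 <= j < N.+1) (muN \o_(i.+1) ((-1) ^+ j.-1 *: (muN \o_(j) mu2)))).
  rewrite big_nat; apply: ideal_sum => j Hj; rewrite opcompZr; apply: ideal_scale.
  have -> : muN \o_(i.+1) (muN \o_(j) mu2) = (muN \o_(i.+1) muN) \o_(i + j) mu2.
    rewrite (@opcomp_nested K N (corolla N MuN) (corolla N MuN)) ?leaves_corolla //=; try lia.
    by congr (_ \o_(_) (_ \o_(_) _)); lia.
  by apply: (compl (ideal_muN_muN Hi') component_mu2); lia.
move: H; rewrite /relation2N opcompDr opcompBr opcompZr opcomp_sumr.
move=> H; have := ideal_scale (-1) (ideal_canr Isum H).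
by rewrite scalerBr !scaleN1r opprK addrC.
Qed.

(** Eliminates [inner' i.+1] from the two preceding congruences. *)
Lemma inner_step i : (1 <= i < N)%N ->
  I (N + N) (inner i - (-1) ^+ N *: inner i.+1).
Proof.
move=> Hi; have := ideal_scale (- (-1) ^+ N) (muN_relation2N Hi).
move=> /(ideal_add (relation2N_muN Hi)); congr (I _ _).
rewrite scalerBr !scaleNr scalerA -expr2 sqrr_sign scale1r opprK.
by rewrite addrA addrAC subrK.
Qed.

Lemma inner_last i : (1 <= i <= N)%N ->
  I (N + N) (inner i - (-1) ^+ (N * (N - i)) *: inner N).
Proof.
move=> Hi; have [m mE] : exists m, (m + i = N)%N by exists (N - i)%N; lia.
have -> : (N - i = m)%N by lia.
elim: m i mE Hi => [|m IH] i mE Hi.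
  rewrite muln0 expr0 scale1r; have -> : i = N by lia.
  by rewrite subrr; apply: ideal0 idI _.
have /IH/(_ _)/(ideal_scale ((-1) ^+ N)) H : (m + i.+1 = N)%N by lia.
have {}H := H ltac:(lia).
have /(ideal_add)/(_ H) := inner_step (i := i) ltac:(lia); congr (I _ _).
by rewrite scalerBr scalerA -exprD mulnS addrA subrK.
Qed.

Lemma mu2_mu2pow k : I k.+2 (mu2 \o_(1) mu2pow k - mu2pow k.+1).
Proof.
elim: k => [|k IH].
  rewrite /= !opcomp1 !mul0r; have -> : graft (corolla N Mu2) 1 Leaf = corolla N Mu2 by [].
  by rewrite subrr; apply: ideal0 idI _.
have E1 : mu2 \o_(1) (mu2 \o_(2) mu2pow k) = (mu2 \o_(1) mu2) \o_(2) mu2pow k.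
  by rewrite mu2powE (@opcomp_nested K N (corolla N Mu2) (corolla N Mu2)).
have E2 : (mu2 \o_(2) mu2) \o_(2) mu2pow k = mu2 \o_(2) (mu2 \o_(1) mu2pow k).
  by rewrite mu2powE (@opcomp_nested K N (corolla N Mu2) (corolla N Mu2)).
have H1 : I k.+3 ((mu2 \o_(1) mu2 - mu2 \o_(2) mu2) \o_(2) mu2pow k).
  by apply: (compl ideal_mu2_mu2 (@component_mu2pow k)); lia.
have H2 : I k.+3 (mu2 \o_(2) (mu2 \o_(1) mu2pow k - mu2pow k.+1)).
  by apply: (compr component_mu2 IH); lia.
have := ideal_add H1 H2; rewrite opcompBl opcompBr E2 -E1.
by rewrite addrA subrK.
Qed.

(** Grafting mu_2^(k-1) on leaf i of [inner_last] gives the right-hand side. On the left it produces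
    (mu_2 o_1 mu_2^(k-1)) o_(k+1) mu_N inside mu_N, which [mu2_mu2pow] turns into mu_2^(k) o_(k+1)
    mu_N. *)
Lemma ideal_adjoined k i : (1 <= k)%N -> (1 <= i <= N - 1)%N ->
  I (N + N + k - 1) (muN \o_(i) (mu2pow k \o_(k.+1) muN)
    - (-1) ^+ (N * (i - 1)) *:
      ((muN \o_(N) (mu2 \o_(2) muN)) \o_(i) mu2pow (k - 1))).
Proof.
case: k => // k _ Hi; rewrite (_ : (k.+1 - 1)%N = k); last by rewrite subn1.
rewrite -/(inner N).
have E1 : inner i \o_(i) mu2pow k =
    muN \o_(i) ((mu2 \o_(1) mu2pow k) \o_(k.+2) muN).
  pose T := graft (corolla N Mu2) 2 (corolla N MuN).
  have TE : mu2 \o_(2) muN = << T >>.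
    by rewrite opcomp1 (rdeg_corolla N Mu2) mulr0 expr0z.
  rewrite /inner TE mu2powE (@opcomp_nested K N (corolla N MuN) T)
          ?leaves_corolla; last 2 first.
  - by rewrite /=; lia.
  - by rewrite leaves_graft ?leaves_corolla //=; lia.
  rewrite -TE (_ : i - i + 1 = 1)%N; last by lia.
  rewrite (@opcomp_left K N (corolla N Mu2) (corolla N MuN)) // tdeg_comb mulr0 expr0z scale1r.
  by congr (_ \o_(_) (_ \o_(_) _)); rewrite leaves_comb /=; lia.
have H1 : I (N + N + k.+1 - 1)
    (muN \o_(i) ((mu2 \o_(1) mu2pow k - mu2pow k.+1) \o_(k.+2) muN)).
  have H : I (k.+2 + N - 1) ((mu2 \o_(1) mu2pow k - mu2pow k.+1) \o_(k.+2) muN).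
    by apply: (compl (mu2_mu2pow k) component_muN); lia.
  by apply: (compr component_muN H); lia.
have H2 : I (N + N + k.+1 - 1)
    ((inner i - (-1) ^+ (N * (N - i)) *: inner N) \o_(i) mu2pow k).
  have Hi' : (1 <= i <= N)%N by lia.
  by apply: (compl (inner_last Hi') (@component_mu2pow k)); lia.
(* The two exponents add up to N (N - 1), which is even. *)
have -> : (-1) ^+ (N * (i - 1)) = (-1) ^+ (N * (N - i)) :> K.
  rewrite -signr_odd -[RHS]signr_odd !oddM; congr (_ ^+ _); congr nat_of_bool.
  case oN: (odd N) => //=; rewrite !oddB; [|lia|lia].
  by rewrite oN; case: (odd i).
have regroup (a b c : elt) : a - b - (a - c) = c - b.
  by rewrite opprB addrC addrA subrK.
by have := ideal_sub H2 H1; rewrite !opcompBl opcompBr opcompZl E1 regroup.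
Qed.

(** A nonzero element determines its arity n; the element 0 lies in the ideal in every arity. *)
Lemma ideal_groebner n g : groebner_relation N g -> component N n g -> I n g.
Proof.
case=> [f Rf cf|k i k1 Hi cg]; first exact: relI.
have Ig := ideal_adjoined k1 Hi; set h := (X in I _ X) in Ig; rewrite -/h in cg *.
have [->|h0] := eqVneq h 0; first exact: ideal0 idI _.
have [t t_h] := msupp_witness h0.
have [_ <-] := cg t t_h.
by have [_ ->] := ideal_component idI Ig t_h.
Qed.

End Ideal.

Lemma groebner_generated g : groebner_relation N g ->
  exists n, ideal_generated N (@defining_relation K N) n g.
Proof.
case=> [f Rf|k i k1 Hi].
  have [n cf] := component_defining Rf.
  by exists n => I idI relI; apply: relI.
exists (N + N + k - 1)%N => I idI relI; exact: ideal_adjoined.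
Qed.

Lemma ideal_generated_groebner n f :
  ideal_generated N (@defining_relation K N) n f <->
  ideal_generated N (@groebner_relation K N) n f.
Proof.
split=> If I idI relI; apply: If => // m g Rg cg; last exact: ideal_groebner.
by apply: relI => //; constructor.
Qed.

End AdjoinedRelations.

(** * Leading terms *)

Arguments divides : simpl never.

Section LeadingTerms.

Context (K : fieldType) (N : nat) (hN : (3 <= N)%N).

Local Notation elt := {malg K[ptree]}.
Local Notation "f \o_( i ) g" := (opcomp N f i g)
  (at level 40, i at level 99, left associativity).
Local Notation mu2 := (mu2 K N).
Local Notation muN := (muN K N).
Local Notation mu2pow := (mu2pow K N).

Implicit Types f g : elt.

Lemma leading_term_unique f s t : leading_term f s -> leading_term f t -> s = t.
Proof.
move=> [s_f s_max] [t_f t_max]; case: (s_max t t_f) => // ts.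
by case: (t_max s s_f) => // /(tree_lt_trans ts); rewrite tree_lt_irr.
Qed.

Lemma max_exists (r : seq ptree) n : r <> [::] ->
  (forall t, t \in r -> wf N t /\ leaves t = n) ->
  exists2 t, t \in r & forall s, s \in r -> s = t \/ tree_lt s t.
Proof.
elim: r => // t [|u r] IH _ cr.
  by exists t => [|s]; rewrite inE // => /eqP ->; left.
have [//|s s_r|m m_r m_max] := IH; first by apply: cr; rewrite inE s_r orbT.
have [wf_t Lt] := cr t (mem_head _ _).
have [wf_m Lm] : wf N m /\ leaves m = n by apply: cr; rewrite inE m_r orbT.
have [/orP[/eqP mt|mt]|tm] := tree_total hN wf_m wf_t (etrans Lm (esym Lt)).
- exists m => [|s]; first by rewrite inE m_r orbT.
  by rewrite inE => /orP[/eqP ->|/m_max //]; left.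
- exists t => [|s]; first exact: mem_head.
  rewrite inE => /orP[/eqP ->|/m_max[->|sm]]; [by left|by right|right].
  exact: tree_lt_trans sm mt.
exists m => [|s]; first by rewrite inE m_r orbT.
by rewrite inE => /orP[/eqP ->|/m_max //]; right.
Qed.

Lemma leading_term_exists n f : component N n f -> f != 0 ->
  exists t, leading_term f t.
Proof.
move=> cf /msupp_witness [t0 t0_f].
have [|t t_f t_max] := @max_exists (msupp f) n _ cf; last by exists t.
by move=> f0; move: t0_f; rewrite -[t0 \in msupp f]/(t0 \in (msupp f : seq _)) f0.
Qed.

Definition below (t : ptree) f : Prop := forall s, s \in msupp f -> tree_lt s t.

Lemma below_add t f g : below t f -> below t g -> below t (f + g).
Proof.
move=> bf bg s /(fsubsetP (msuppD_le _ _)).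
by rewrite in_fsetU => /orP[/bf|/bg].
Qed.

Lemma below_scale t c f : below t f -> below t (c *: f).
Proof. by move=> bf s /(fsubsetP (msuppZ_le _ _))/bf. Qed.

Lemma below_sum t r (P : pred nat) (F : nat -> elt) :
  (forall i, P i -> below t (F i)) -> below t (\sum_(i <- r | P i) F i).
Proof.
move=> bF; elim/big_ind: _ => //; last exact: below_add.
by move=> s; rewrite msupp0.
Qed.

Lemma belowU t c s : tree_lt s t -> below t (<< c *g s >> : elt).
Proof. by move=> st u /(fsubsetP msuppU_le); rewrite in_fset1 => /eqP ->. Qed.

Lemma leading_termU c t f : c != 0 -> below t f -> leading_term (<< c *g t >> + f) t.
Proof.
move=> c0 bf; split.
  rewrite -mcoeff_neq0 mcoeffD mcoeffUU (_ : f@_t = 0) ?addr0 //.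
  by apply: mcoeff_outdom; apply/negP => /bf; rewrite tree_lt_irr.
move=> s /(fsubsetP (msuppD_le _ _)); rewrite in_fsetU => /orP[|/bf]; last by right.
by move=> /(fsubsetP msuppU_le); rewrite in_fset1 => /eqP ->; left.
Qed.

Lemma graft_nseq a p rest t :
  graft (Node a (nseq p Leaf ++ Leaf :: rest)) p.+1 t =
  Node a (nseq p Leaf ++ t :: rest).
Proof. by rewrite /=; congr Node; elim: p => //= p IH; rewrite subn1 /= IH. Qed.

Lemma graft_corolla a i t : (1 <= i <= garity N a)%N ->
  graft (corolla N a) i t =
  Node a (nseq i.-1 Leaf ++ t :: nseq (garity N a - i) Leaf).
Proof.
case: i => // i Hi; rewrite -[i.+1.-1]/i -graft_nseq /corolla; congr graft.
by congr Node; rewrite -[Leaf :: _]/(nseq _.+1 _) -nseqD; congr nseq; lia.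
Qed.

Lemma graft_comb k t : graft (comb k Leaf) k.+1 t = comb k t.
Proof.
elim: k => //= k IH; rewrite -/(comb k Leaf) -/(comb k t).
by rewrite leaves_comb /= addn1 subn1 /= leqnn IH.
Qed.

Lemma opcomp_corollas a b i : (1 <= i <= garity N a)%N ->
  << corolla N a >> \o_(i) << corolla N b >> =
  << Node a (nseq i.-1 Leaf ++ corolla N b :: nseq (garity N a - i) Leaf) >> :> elt.
Proof. by move=> Hi; rewrite opcomp1 rdeg_corolla mulr0 expr0z graft_corolla. Qed.

Lemma lead_Rel22 : leading_term (star N 2 mu2 2 0 mu2)
  (Node Mu2 [:: corolla N Mu2; Leaf]).
Proof.
rewrite /star big_ltn // big_nat1 mul0r !add0r subrr mulr0 expr0z scale1r.
rewrite /Defs.mu2 !opcomp_corollas //; apply: leading_termU; first exact: oner_neq0.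
exact/below_scale/belowU.
Qed.

Lemma lead_Rel2N : leading_term
  (star N 2 mu2 N (2 - N%:Z) muN + star N N muN 2 0 mu2)
  (Node Mu2 [:: corolla N MuN; Leaf]).
Proof.
set t := Node Mu2 _.
have E1 : mu2 \o_(1) muN = << t >> by apply: opcomp_corollas.
have E2 := @opcomp_corollas Mu2 MuN 2 isT.
rewrite (relation2NE K hN) /relation2N E1 -addrA scaleU.
apply: leading_termU; first by rewrite mulr1 signr_eq0.
(* Successors are exposed so that first paths compute: mu_2 mu_N for [t], against mu_2 for mu_2 o_2
   mu_N and mu_N or mu_N mu_2 for the others. *)
have [p pE] : exists p, N = p.+2.+1 by exists (N - 3)%N; lia.
apply: below_add.
  rewrite -scaleN1r [mu2 \o_(2) muN]E2; apply/below_scale/belowU.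
  rewrite tree_lt_leaves; last by rewrite /= !sumn_leaves_nseq; lia.
  by rewrite /t pE.
rewrite big_nat; apply: below_sum => j Hj.
rewrite [muN \o_(j) mu2](@opcomp_corollas MuN Mu2 j Hj).
apply/below_scale/belowU; rewrite tree_lt_leaves; last first.
  by rewrite /= map_cat sumn_cat /= !sumn_leaves_nseq; lia.
rewrite /t /= pE /=; case: j Hj => // [] [|j] _ //=.
Qed.

Lemma lead_RelNN i : (1 <= i <= N)%N -> leading_term (muN \o_(i) muN) (nested N 0 i).
Proof.
move=> Hi; rewrite /Defs.muN opcomp_corollas // -[<< _ >>]addr0; apply: leading_termU.
  exact: oner_neq0.
by move=> s; rewrite msupp0.
Qed.

(** The first i - 1 inputs of mu_N are leaves on both sides. As i < N, the i-th input is [word k] on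
    the right-hand side, against a comb of length k ending in mu_N. *)
Lemma lead_Adjoined k i : (1 <= k)%N -> (1 <= i <= N - 1)%N ->
  leading_term (muN \o_(i) (mu2pow k \o_(k.+1) muN)
    - (-1) ^+ (N * (i - 1)) *:
      ((muN \o_(N) (mu2 \o_(2) muN)) \o_(i) mu2pow (k - 1))) (nested N k i).
Proof.
move=> k0 Hi; rewrite !mu2powE /Defs.mu2 /Defs.muN opcomp1 graft_comb opcompU.
rewrite graft_corolla; last by rewrite /=; lia.
apply: leading_termU; first by rewrite !mulf_neq0 ?sg_neq0 ?oner_neq0.
rewrite -scaleN1r; apply/below_scale/below_scale.
rewrite opcomp1 (@graft_corolla Mu2) // opcompU (@graft_corolla MuN); last by rewrite /=; lia.
rewrite opcompU; apply: belowU; set X := Node Mu2 _.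
have -> : nseq N.-1 Leaf ++ X :: nseq (garity N MuN - N) Leaf =
    nseq i.-1 Leaf ++ Leaf :: (nseq (N - 1 - i) Leaf ++ [:: X]).
  rewrite /= subnn -cat_cons -[Leaf :: _]/(nseq _.+1 _) catA -nseqD.
  by congr (nseq _ _ ++ _); lia.
have -> : graft (Node MuN (nseq i.-1 Leaf ++ Leaf :: (nseq (N - 1 - i) Leaf ++ [:: X]))) i
    (comb (k - 1) Leaf) =
    Node MuN (nseq i.-1 Leaf ++ word k :: (nseq (N - 1 - i) Leaf ++ [:: X])).
  by rewrite [X in graft _ X _](_ : i = i.-1.+1) ?graft_nseq /word ?subn1 //; lia.
apply: tree_lt_muN_word => //.
- by rewrite leaves_comb leq_addr.
- exact: paths_word_comb.
rewrite /= !map_cat !sumn_cat /= !map_cat !sumn_cat !sumn_leaves_nseq /=.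
by rewrite leaves_word // leaves_comb /= !sumn_leaves_nseq; lia.
Qed.

Lemma groebner_leading g : groebner_relation N g ->
  exists t, leading_term g t /\ lead N t.
Proof.
case=> [f [||i Hi]|k i k0 Hi].
- by exists (Node Mu2 [:: corolla N Mu2; Leaf]); split; [exact: lead_Rel22 | exact: Or31].
- by exists (Node Mu2 [:: corolla N MuN; Leaf]); split; [exact: lead_Rel2N | exact: Or32].
- by exists (nested N 0 i); split; [exact: lead_RelNN | apply: lead_nested => //; left].
exists (nested N k i); split; first exact: lead_Adjoined.
by apply: lead_nested; [lia | right; lia].
Qed.

Lemma leading_groebner t : lead N t ->
  exists2 g : elt, groebner_relation N g & leading_term g t.
Proof.
case=> [->|->|[k [i [Hi Hk ->]]]].
- by eexists; [apply/Defining/Rel22 | exact: lead_Rel22].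
- by eexists; [apply/Defining/Rel2N | exact: lead_Rel2N].
case: k Hk => [_|k [//|iN]].
  by eexists; [apply/Defining/RelNN/Hi | exact: lead_RelNN].
by eexists; [apply: (@Adjoined _ _ k.+1 i) | apply: lead_Adjoined] => //; lia.
Qed.

(** * Leading terms determine their relations and do not divide one another *)

Lemma nested_inj k i k' i' : (1 <= i <= N)%N -> (1 <= i' <= N)%N ->
  nested N k i = nested N k' i' -> k = k' /\ i = i'.
Proof.
have comb_Leaf j : comb j (corolla N MuN) <> Leaf by case: j.
have comb_inj j j' : comb j (corolla N MuN) = comb j' (corolla N MuN) -> j = j'.
  by elim: j j' => [|j IH] [|j'] // [/IH ->].
move=> Hi Hi' [E].
have nthE l j p : (p < N)%N -> (1 <= j <= N)%N ->
    nth Leaf (nseq j.-1 Leaf ++ comb l (corolla N MuN) :: nseq (N - j) Leaf) p =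
    if p == j.-1 then comb l (corolla N MuN) else Leaf.
  move=> Hp Hj; rewrite nth_cat size_nseq nth_nseq; case: ltngtP => // Hpj.
    have -> : (p - j.-1 = (p - j.-1).-1.+1)%N by lia.
    by rewrite /= nth_nseq if_same.
  by rewrite Hpj subnn.
have := congr1 (fun ss => nth Leaf ss i.-1) E; rewrite !nthE ?eqxx //; try lia.
case: eqP => [ii /comb_inj -> |_ /comb_Leaf //]; split=> //; lia.
Qed.

Lemma groebner_leading_inj f g t : groebner_relation N f -> groebner_relation N g ->
  leading_term f t -> leading_term g t -> f = g.
Proof.
have inv h : groebner_relation N h -> leading_term h t ->
    [\/ h = star N 2 mu2 2 0 mu2 /\ t = Node Mu2 [:: corolla N Mu2; Leaf],
        h = star N 2 mu2 N (2 - N%:Z) muN + star N N muN 2 0 mu2 /\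
        t = Node Mu2 [:: corolla N MuN; Leaf] |
        exists k i, [/\ (1 <= i <= N)%N, t = nested N k i &
          h = if k is 0 then muN \o_(i) muN else
            muN \o_(i) (mu2pow k \o_(k.+1) muN) - (-1) ^+ (N * (i - 1)) *:
              ((muN \o_(N) (mu2 \o_(2) muN)) \o_(i) mu2pow (k - 1))]].
  case=> [h' [||i Hi]|[//|k] i k0 Hi] /leading_term_unique tE.
  - by apply: Or31; rewrite (tE _ lead_Rel22).
  - by apply: Or32; rewrite (tE _ lead_Rel2N).
  - by apply: Or33; exists 0%N, i; rewrite (tE _ (lead_RelNN Hi)).
  apply: Or33; exists k.+1, i; rewrite (tE _ (lead_Adjoined k0 Hi)); split=> //; lia.
move=> Rf Rg /(inv f Rf) ft /(inv g Rg).
case: ft => [[-> ->]|[-> ->]|[k [i [Hi -> ->]]]] [[-> ]|[-> ]|[k' [i' [Hi' E ->]]]] //.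
by have [-> ->] := nested_inj Hi Hi' E.
Qed.

Lemma lead_root t : lead N t -> exists a ts, t = Node a ts.
Proof. by case=> [->|->|[k [i [_ _ ->]]]]; do 2!eexists. Qed.

Lemma nested_subtree k i ss : (1 <= i <= N)%N -> size ss = N ->
  subtree_at (nested N k i) (Node MuN ss) =
  subtree_at (comb k (corolla N MuN)) (nth Leaf ss i.-1).
Proof.
move=> Hi sz; rewrite /nested -[subtree_at _ _]/(true && all2 subtree_at _ _) /=.
by rewrite subtree_at_plug ?sz; [rewrite (_ : _ == _) //; apply/eqP; lia | lia].
Qed.

Lemma divides_node t a ss :
  divides t (Node a ss) = subtree_at t (Node a ss) || has (divides t) ss.
Proof. by []. Qed.

Lemma lead_not_divides_comb t k a : lead N t -> ~~ divides t (comb k (corolla N a)).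
Proof.
move=> Lt; have [b [ts tE]] := lead_root Lt.
have no_Leaf : divides t Leaf = false by rewrite tE.
elim: k => [|k IH]; last first.
  have -> : comb k.+1 (corolla N a) = Node Mu2 [:: Leaf; comb k (corolla N a)] by [].
  rewrite divides_node [has _ _]/= no_Leaf (negPf IH) !orbF.
  by case: Lt => [->|->|[j [i [_ _ ->]]]].
rewrite [comb 0 _]/(corolla N a) divides_node negb_or; apply/andP; split; last first.
  by apply/hasPn => s /nseqP[-> _]; rewrite no_Leaf.
case: Lt => [->|->|[j [i [Hi _ ->]]]]; try by case: a.
case: a => //; rewrite nested_subtree ?size_nseq // nth_nseq if_same.
by case: j.
Qed.

(** The inputs of the root of [s] are leaves and combs ending in a corolla, too small to contain
    [t]; an occurrence of [t] at the root forces equality. *)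
Lemma lead_divides s t : lead N s -> lead N t -> divides t s -> t = s.
Proof.
move=> Ls Lt; have [b [ts tE]] := lead_root Lt.
have no_Leaf : divides t Leaf = false by rewrite tE.
have no_comb k a := negPf (lead_not_divides_comb k a Lt).
have no_corolla a : divides t (corolla N a) = false := no_comb 0%N a.
case: Ls => [->|->|[k [i [Hi _ ->]]]].
- rewrite divides_node [has _ _]/= no_corolla no_Leaf orbF.
  by case: Lt => [->|->|[j [l [_ _ ->]]]].
- rewrite divides_node [has _ _]/= no_corolla no_Leaf orbF.
  by case: Lt => [->|->|[j [l [_ _ ->]]]].
have nthE p : nth Leaf (nseq i.-1 Leaf ++ comb k (corolla N MuN) :: nseq (N - i) Leaf) p =
    if p == i.-1 then comb k (corolla N MuN) else Leaf.
  rewrite nth_cat size_nseq nth_nseq; case: ltngtP => // Hpj.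
    have -> : (p - i.-1 = (p - i.-1).-1.+1)%N by lia.
    by rewrite /= nth_nseq if_same.
  by rewrite Hpj subnn.
have sz : size (nseq i.-1 Leaf ++ comb k (corolla N MuN) :: nseq (N - i) Leaf) = N.
  by rewrite size_cat /= !size_nseq; lia.
rewrite divides_node => /orP[|/hasP[u]]; last first.
  rewrite mem_cat inE => /or3P[/nseqP[-> _]|/eqP ->|/nseqP[-> _]].
  - by rewrite no_Leaf.
  - by rewrite no_comb.
  by rewrite no_Leaf.
case: Lt => [->|->|[j [l [Hl _ ->]]]] //.
rewrite nested_subtree // nthE; case: eqP => [il|_]; last by case: j.
have -> : l = i by lia.
have H : forall j k, subtree_at (comb j (corolla N MuN)) (comb k (corolla N MuN)) -> j = k.
  by elim=> [|j' IH] [|k'] //= /andP[/IH ->].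
by move/H => ->.
Qed.

Lemma groebner_reduced : reduced (@groebner_relation K N).
Proof.
move=> f g s t Rf Rg fg fs gt; apply/negP => ts; apply: fg.
have [s' [fs' Ls]] := groebner_leading Rf; have [t' [gt' Lt]] := groebner_leading Rg.
rewrite -(leading_term_unique fs fs') in Ls; rewrite -(leading_term_unique gt gt') in Lt.
rewrite (lead_divides Ls Lt ts) in gt; exact: groebner_leading_inj Rf Rg fs gt.
Qed.

End LeadingTerms.

Theorem theorem3p1 (K : fieldType) (N : nat) (hN : (3 <= N)%N) :
  groebner_basis N (ideal_generated N (@defining_relation K N))
    (@groebner_relation K N)
  /\ reduced (@groebner_relation K N).
Proof.
split; last exact: groebner_reduced.
split; [exact: groebner_generated | exact: ideal_generated_groebner |].
move=> n f If f0.
(* The components themselves form an ideal that contains the relations. *)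
have cf : component N n f by apply: If => //; exact: component_is_ideal.
have [t ft] := leading_term_exists hN cf f0; exists t; split=> //.
(* If no leading term of a relation divided t, then t would be normal, which a leading term of the
   ideal cannot be. *)
apply: NNPP => irr.
have [_ wf_t] : leaves t = n /\ wf N t by have [? ?] := cf t ft.1.
have [|m [u [cs [V tE]]]] := nft_irreducible hN wf_t; last first.
  exact: (@leading_not_nft K N hN n f t m u cs If cf ft V tE).
move=> s Ls; apply/negP => st; apply: irr.
by have [g Rg gs] := leading_groebner K hN Ls; exists g, s.
Qed.
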